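(* Let $\alpha\ge 0$ and let $f\in\mathcal{W}(\alpha)$ with logarithmic coefficients $\gamma_1,\gamma_2$. Then $$|\gamma_2|-|\gamma_1|\le\frac{1}{3(1+2\alpha)}\quad\text{for }\alpha\ge 0,$$ and $$|\gamma_2|-|\gamma_1|\ge\begin{cases}-\dfrac{1}{\sqrt{8\alpha^2+10\alpha+5}}, & 0\le\alpha\le 2.232,\\[2mm] -\dfrac{1}{3(1+2\alpha)}-\dfrac{3(1+2\alpha)}{4(8\alpha^2+10\alpha+5)}, & \alpha>2.232.\end{cases}$$ All these inequalities are sharp.
   Context: Let $\mathbb{D}=\{z\in\mathbb{C}:|z|<1\}$ and let $\mathcal{A}$ be the class of holomorphic functions $f$ on $\mathbb{D}$ with $f(0)=0$ and $f'(0)=1$, written $f(z)=z+\sum_{n\ge 2}a_nz^n$. For $\alpha\ge 0$, $\mathcal{W}(\alpha)$ is the class of all $f\in\mathcal{A}$ with $\mathrm{Re}\,\{f'(z)+\alpha z f''(z)\}>0$ for all $z\in\mathbb{D}$. It is known that every $f\in\mathcal{W}(\alpha)$ is univalent in $\mathbb{D}$. The logarithmic coefficients $\gamma_n$ of $f$ are defined by $\log\frac{f(z)}{z}=2\sum_{n=1}^\infty\gamma_nz^n$ near $0$ (branch of the logarithm vanishing at $z=0$); in particular $\gamma_1=\frac12a_2$ and $\gamma_2=\frac12\left(a_3-\frac12a_2^2\right)$. Sharp means that equality is attained by some $f\in\mathcal{W}(\alpha)$ (possibly a different $f$ for each inequality).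
   Formalization: Sharpness of the lower bound is stated with the exact threshold 1/2+√3 ≈ 2.23205 instead of 2.232, because for 2.232 < α < 1/2+√3 the second expression is strictly below the attained minimum −1/√(8α²+10α+5); the bounds themselves are also proved with 2.232. *)

(* Defs.v *)
From Stdlib Require Import Reals.
From Coquelicot Require Import Coquelicot.

Local Open Scope C_scope.

Definition holomorphic_on_disk (f : C -> C) : Prop :=
  forall z : C, (Cmod z < 1)%R ->
    @ex_derive C_AbsRing C_NormedModule f z.

(* [C_derive] is a total function; it is the complex derivative wherever
   [ex_derive] holds (lemma [C_derive_correct]), so in particular at every
   point of the disk when [f] is holomorphic there (and then also for the second
   derivative, [f'] being holomorphic).  Values of [f] outside the disk are
   irrelevant. *)
Definition class_A (f : C -> C) : Prop :=
  holomorphic_on_disk f /\ f 0 = 0 /\ C_derive f 0 = 1.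

Definition class_W (alpha : R) (f : C -> C) : Prop :=
  class_A f /\
  forall z : C, (Cmod z < 1)%R ->
    (0 < Re (C_derive f z + alpha * z * C_derive (C_derive f) z))%R.

Definition Cexp (z : C) : C :=
  (exp (Re z) * cos (Im z), exp (Re z) * sin (Im z))%R.

(* log (f z / z) = 2 * sum_{n >= 1} gamma_n z^n near 0.  The sum [L] has no
   constant term, so 2 * L is a continuous logarithm of f z / z tending to 0 at
   0: the equation through [Cexp] selects the branch vanishing at 0.  The point
   0 is excluded because f z / z is only defined there by continuation.
   The value [gamma 0] is unconstrained. *)
Definition log_coefficients (f : C -> C) (gamma : nat -> C) : Prop :=
  exists r : R, (0 < r)%R /\
    forall z : C, (0 < Cmod z < r)%R ->
      exists L : C,
        @is_series C_AbsRing C_NormedModule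
          (fun n : nat => gamma (S n) * z ^ (S n)) L /\
        Cexp (2 * L) = f z / z.

Definition log_coeff_gap (gamma : nat -> C) : R :=
  (Cmod (gamma 2%nat) - Cmod (gamma 1%nat))%R.

Local Open Scope R_scope.

Definition lower_bound (t alpha : R) : R :=
  if Rle_dec alpha t
  then - (1 / sqrt (8 * alpha ^ 2 + 10 * alpha + 5))
  else - (1 / (3 * (1 + 2 * alpha)))
       - 3 * (1 + 2 * alpha) / (4 * (8 * alpha ^ 2 + 10 * alpha + 5)).

(* The positive root 2.23205... of 4 x^2 - 4 x - 11, where the two cases of
   [lower_bound] agree.  The decimal 2.232 is its rounding: for alpha strictly
   between 2.232 and this root the second case is a valid lower bound but is
   strictly smaller than the first one, hence is not attained. *)
Definition threshold : R := 1 / 2 + sqrt 3.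

(* Main.v *)
Require Import Defs.
From Stdlib Require Import Reals Lra Lia Psatz ClassicalEpsilon.
From Coquelicot Require Import Coquelicot.

(** Why the theorem holds.

    Put [p = f' + alpha z f'' = 1 + c1 z + c2 z^2 + ...].  Then [c1 = 2 (1 + alpha) a2] and
    [c2 = 3 (1 + 2 alpha) a3], and [Re p > 0] is all that is known.  Positivity of the Toeplitz
    form of [p] gives the sharp coefficient region [|c2 - c1^2 / 2| <= 2 - |c1|^2 / 2]
    ([caratheodory]).  With [u = |gamma_1|], [E = 3 (1 + 2 alpha)] and
    [D = 8 alpha^2 + 10 alpha + 5] the triangle inequality turns this region into
    [(D u^2 - 1) / E <= |gamma_2| <= 1 / E - u^2] ([log_coefficients_region]).  The upper bound
    follows at once.  The two lower bounds are the minimum over [u] of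
    [max 0 ((D u^2 - 1) / E) - u]: the parabola has its vertex at [u = E / (2 D)], and its zero is
    [u = 1 / sqrt D]; the vertex lies beyond the zero exactly when [E^2 > 4 D], that is, when
    [alpha > threshold].

    For sharpness take [p = 1 + sum (eta^n + conj eta^n) z^n] with [|eta| = 1], an average of two
    Moebius maps onto the right half plane.  Choosing [Re eta] prescribes [u], and [c1^2], [c2]
    are then real with [c2 - c1^2 / 2] pointing in the direction opposite to [c1^2], so that
    [|gamma_2| = |D u^2 - 1| / E] ([extremal_gap]).  The values [u = 0], [1 / sqrt D] and
    [E / (2 D)] give the three equalities.

    What remains is complex analysis.  Only pointwise differentiability of [f] is given, so
    Goursat's bisection argument is needed.  It is carried out for the image of a square under a
    smooth map ([goursat]), which directly says that integrals over circles do not change when the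
    circle is moved through a domain of holomorphy ([circle_homotopy]).  Cauchy's formula on
    centred circles and the expansion of its kernel follow, hence Taylor series on the full disk
    with integral formulas for the coefficients ([taylor_disk]).  Finally [gamma_1] and [gamma_2]
    are read off by comparing expansions modulo [O(z^3)] ([log_coefficients_values]), and
    logarithmic coefficients exist because [g' / g] has a power series near 0 when
    [g z = f z / z] ([log_coefficients_exist]). *)

Local Open Scope R_scope.

(** * Complex differentiability *)

(** Written with epsilons, so that the estimates below stay free of filters and of the choice of a
    normed-module structure on [C]; [cderiv_is_derive] and [path_deriv_is_derive] are the bridges. *)
Definition is_cderiv (f : C -> C) (z l : C) : Prop :=
  forall eps, 0 < eps -> exists d, 0 < d /\
    forall w, Cmod (w - z) < d -> Cmod (f w - f z - l * (w - z)) <= eps * Cmod (w - z).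

Lemma cderiv_is_derive f z l :
  is_cderiv f z l <-> is_derive (K := C_AbsRing) (V := C_NormedModule) f z l.
Proof.
assert (E : forall w, minus (minus (f w) (f z)) (scal (minus w z) l) = (f w - f z - l * (w - z))%C).
{ intros w. unfold minus, plus, opp, scal; simpl. unfold mult; simpl. ring. }
split.
- intros H; split.
  + apply is_linear_scal_l.
  + intros x Hx.
    apply (is_filter_lim_locally_unique (V := AbsRing_NormedModule C_AbsRing)) in Hx. subst x.
    intros [eps He]. destruct (H eps He) as [d [Hd Hw]].
    exists (mkposreal d Hd). intros y Hy.
    exact (Rle_trans _ _ _ (Req_le _ _ (f_equal Cmod (E y))) (Hw y Hy)).
- intros [_ H] eps He.
  destruct (H z (fun P HP => HP) (mkposreal eps He)) as [[d Hd] Hw].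
  exists d; split; [exact Hd|]. intros w Hy.
  exact (Rle_trans _ _ _ (Req_le _ _ (f_equal Cmod (eq_sym (E w)))) (Hw w Hy)).
Qed.

Lemma cderiv_C_derive f z l : is_cderiv f z l -> C_derive f z = l.
Proof.
intros H. apply is_C_derive_unique. apply cderiv_is_derive, H.
Qed.

Lemma ex_derive_cderiv f z :
  @ex_derive C_AbsRing C_NormedModule f z <-> exists l, is_cderiv f z l.
Proof.
split; intros [l H]; exists l; apply cderiv_is_derive, H.
Qed.

Lemma cderiv_ext f g z l : (forall w, f w = g w) -> is_cderiv f z l -> is_cderiv g z l.
Proof.
intros E H eps He. destruct (H eps He) as [d [Hd Hw]]. exists d; split; [exact Hd|].
intros w Hlt. rewrite <- !E. now apply Hw.
Qed.

(** The usual source of derivatives given by explicit estimates: inversion, power series, [Cexp]. *)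
Lemma cderiv_quadratic f z l K d :
  0 < d ->
  (forall w, Cmod (w - z) < d -> Cmod (f w - f z - l * (w - z)) <= K * Cmod (w - z) ^ 2) ->
  is_cderiv f z l.
Proof.
intros Hd H eps He.
assert (HK : 0 < Rabs K + 1) by (pose proof (Rabs_pos K); lra).
exists (Rmin d (eps / (Rabs K + 1))); split.
{ apply Rmin_case; [exact Hd|]. now apply Rdiv_lt_0_compat. }
intros w Hw.
eapply Rle_trans; [apply H; apply Rlt_le_trans with (1 := Hw), Rmin_l|].
assert (Hw2 : Cmod (w - z) < eps / (Rabs K + 1)).
{ apply Rlt_le_trans with (1 := Hw), Rmin_r. }
assert (Hm : Cmod (w - z) * (Rabs K + 1) <= eps).
{ apply Rmult_le_reg_r with (/ (Rabs K + 1)); [now apply Rinv_0_lt_compat|].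
  rewrite Rmult_assoc, Rinv_r, Rmult_1_r by lra. unfold Rdiv in Hw2; lra. }
pose proof (Cmod_ge_0 (w - z)). pose proof (Rle_abs K).
simpl. rewrite Rmult_1_r, <- Rmult_assoc. apply Rmult_le_compat_r; [easy|]. nra.
Qed.

Lemma cderiv_const c z : is_cderiv (fun _ => c) z 0.
Proof.
intros eps He; exists 1; split; [lra|]. intros w _.
replace (c - c - 0 * (w - z))%C with (RtoC 0) by ring. rewrite Cmod_0.
pose proof (Cmod_ge_0 (w - z)); nra.
Qed.

Lemma cderiv_id z : is_cderiv (fun w => w) z 1.
Proof.
intros eps He; exists 1; split; [lra|]. intros w _.
replace (w - z - 1 * (w - z))%C with (RtoC 0) by ring. rewrite Cmod_0.
pose proof (Cmod_ge_0 (w - z)); nra.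
Qed.

Lemma cderiv_plus f g z l m :
  is_cderiv f z l -> is_cderiv g z m -> is_cderiv (fun w => f w + g w)%C z (l + m).
Proof.
intros Hf Hg. apply cderiv_is_derive.
apply (is_derive_plus (K := C_AbsRing) (V := C_NormedModule)); now apply cderiv_is_derive.
Qed.

Lemma cderiv_AbsRing f z l :
  is_cderiv f z l <-> is_derive (K := C_AbsRing) (V := AbsRing_NormedModule C_AbsRing) f z l.
Proof.
split.
- intros H; split.
  + apply is_linear_scal_l.
  + apply cderiv_is_derive, H.
- intros [_ H]. apply cderiv_is_derive. split; [apply is_linear_scal_l|exact H].
Qed.

Lemma cderiv_mult f g z l m :
  is_cderiv f z l -> is_cderiv g z m -> is_cderiv (fun w => f w * g w)%C z (l * g z + f z * m).
Proof.
intros Hf Hg. apply cderiv_AbsRing.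
apply (is_derive_mult (K := C_AbsRing)); try now apply cderiv_AbsRing.
exact Cmult_comm.
Qed.

Lemma cderiv_scal c f z l : is_cderiv f z l -> is_cderiv (fun w => c * f w)%C z (c * l).
Proof.
intros H. replace (c * l)%C with (0 * f z + c * l)%C by ring.
apply (cderiv_mult (fun _ => c)); [apply cderiv_const|exact H].
Qed.

Lemma cderiv_affine P Q z : is_cderiv (fun w => P + Q * w)%C z Q.
Proof.
assert (H : is_cderiv (fun w => P + Q * w)%C z (0 + Q * 1)).
{ apply cderiv_plus; [apply cderiv_const|]. apply cderiv_scal, cderiv_id. }
replace (0 + Q * 1)%C with Q in H by ring. exact H.
Qed.

Lemma cderiv_minus f g z l m :
  is_cderiv f z l -> is_cderiv g z m -> is_cderiv (fun w => f w - g w)%C z (l - m).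
Proof.
intros Hf Hg. apply cderiv_ext with (fun w => f w + (-1) * g w)%C.
{ intros; ring. }
replace (l - m)%C with (l + (-1) * m)%C by ring.
apply cderiv_plus; [exact Hf|]. now apply cderiv_scal.
Qed.

Lemma cderiv_comp f g z l m :
  is_cderiv f (g z) l -> is_cderiv g z m -> is_cderiv (fun w => f (g w)) z (l * m).
Proof.
intros Hf Hg. replace (l * m)%C with (m * l)%C by ring.
apply cderiv_is_derive.
apply (is_derive_comp (K := C_AbsRing) (V := C_NormedModule) f g z l m).
- now apply cderiv_is_derive.
- now apply cderiv_AbsRing.
Qed.

Lemma cderiv_cont f z l : is_cderiv f z l ->
  forall eps, 0 < eps -> exists d, 0 < d /\
    forall w, Cmod (w - z) < d -> Cmod (f w - f z) < eps.
Proof.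
intros H eps He.
destruct (H 1 Rlt_0_1) as [d [Hd Hw]].
assert (HK : 0 < Cmod l + 1) by (pose proof (Cmod_ge_0 l); lra).
exists (Rmin d (eps / (Cmod l + 1))); split.
{ apply Rmin_case; [exact Hd|]. now apply Rdiv_lt_0_compat. }
intros w Hlt.
assert (H1 := Hw w (Rlt_le_trans _ _ _ Hlt (Rmin_l _ _))).
assert (H2 : Cmod (w - z) < eps / (Cmod l + 1)).
{ apply Rlt_le_trans with (1 := Hlt), Rmin_r. }
assert (H3 : Cmod (w - z) * (Cmod l + 1) < eps).
{ apply Rmult_lt_reg_r with (/ (Cmod l + 1)); [now apply Rinv_0_lt_compat|].
  rewrite Rmult_assoc, Rinv_r, Rmult_1_r by lra. exact H2. }
replace (f w - f z)%C with ((f w - f z - l * (w - z)) + l * (w - z))%C by ring.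
eapply Rle_lt_trans; [apply Cmod_triangle|]. rewrite Cmod_mult. lra.
Qed.

Lemma Cmod_minus_sym (a b : C) : Cmod (a - b) = Cmod (b - a).
Proof. replace (a - b)%C with (- (b - a))%C by ring. apply Cmod_opp. Qed.

Lemma Cmod_triangle_minus (a b : C) : Cmod (a - b) <= Cmod a + Cmod b.
Proof. unfold Cminus. rewrite <- (Cmod_opp b). apply Cmod_triangle. Qed.

Lemma Cmod_triangle_rev (a b : C) : Cmod a - Cmod b <= Cmod (a + b).
Proof.
pose proof (Cmod_triangle_minus (a + b) b) as H.
replace (a + b - b)%C with a in H by ring. lra.
Qed.

Lemma Cmod_pow (z : C) n : Cmod (z ^ n) = Cmod z ^ n.
Proof.
induction n; simpl; [apply Cmod_1|]. now rewrite Cmod_mult, IHn.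
Qed.

Lemma Cmod_le_abs (z : C) : Cmod z <= Rabs (fst z) + Rabs (snd z).
Proof.
unfold Cmod. rewrite <- (pow2_abs (fst z)), <- (pow2_abs (snd z)).
pose proof (Rabs_pos (fst z)); pose proof (Rabs_pos (snd z)).
rewrite <- (sqrt_pow2 (Rabs (fst z) + Rabs (snd z))) by lra.
apply sqrt_le_1_alt. nra.
Qed.

Lemma cderiv_inv (z : C) : z <> 0%C -> is_cderiv (fun w => / w)%C z (- / (z * z)).
Proof.
intros Hz. assert (Hm := proj1 (Cmod_gt_0 z) Hz).
apply cderiv_quadratic with (2 / Cmod z ^ 3) (Cmod z / 2); [lra|].
intros w Hw.
assert (Hwz : Cmod z / 2 <= Cmod w).
{ pose proof (Cmod_triangle_rev z (w - z)) as H.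
  replace (z + (w - z))%C with w in H by ring. lra. }
assert (Hw0 : w <> 0%C) by (apply Cmod_gt_0; lra).
replace (/ w - / z - - / (z * z) * (w - z))%C with (((w - z) * (w - z)) / (w * (z * z)))%C.
2:{ field. split; assumption. }
rewrite Cmod_div by (repeat apply Cmult_neq_0; assumption).
rewrite !Cmod_mult.
pose proof (Cmod_ge_0 (w - z)).
apply Rle_trans with ((Cmod (w - z) * Cmod (w - z)) / ((Cmod z / 2) * (Cmod z * Cmod z))).
- apply Rmult_le_compat_l; [nra|]. apply Rinv_le_contravar.
  + repeat apply Rmult_lt_0_compat; lra.
  + apply Rmult_le_compat_r; [nra|exact Hwz].
- right. field. lra.
Qed.

Lemma cderiv_div (f g : C -> C) z l m :
  g z <> 0%C -> is_cderiv f z l -> is_cderiv g z m ->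
  is_cderiv (fun w => f w / g w)%C z ((l * g z - f z * m) / (g z * g z)).
Proof.
intros H0 Hf Hg.
replace ((l * g z - f z * m) / (g z * g z))%C
  with (l * / g z + f z * (- / (g z * g z) * m))%C by (field; exact H0).
apply (cderiv_mult f (fun w => / g w)%C); [exact Hf|].
apply (cderiv_comp Cinv g); [now apply cderiv_inv|exact Hg].
Qed.

Lemma cderiv_pow n (z : C) : is_cderiv (fun w => w ^ n)%C z (INR n * z ^ (pred n)).
Proof.
induction n as [|n IH].
- simpl. replace (0 * 1)%C with (RtoC 0) by ring. apply cderiv_const.
- apply cderiv_ext with (fun w => w * w ^ n)%C; [reflexivity|].
  replace (INR (S n) * z ^ pred (S n))%C with (1 * z ^ n + z * (INR n * z ^ pred n))%C.
  + apply (cderiv_mult (fun w => w)); [apply cderiv_id|exact IH].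
  + rewrite S_INR, RtoC_plus. destruct n; simpl; ring.
Qed.

(** * Paths in the complex plane *)

Definition is_path_deriv (g : R -> C) (t : R) (d : C) : Prop :=
  forall eps, 0 < eps -> exists e, 0 < e /\
    forall s, Rabs (s - t) < e -> Cmod (g s - g t - RtoC (s - t) * d) <= eps * Rabs (s - t).

Lemma norm_C_R (z : C) : norm (K := R_AbsRing) (V := C_R_NormedModule) z = Cmod z.
Proof.
unfold norm; simpl. unfold prod_norm, Cmod. unfold norm; simpl. unfold abs; simpl.
f_equal. change (Rabs (fst z) ^ 2 + Rabs (snd z) ^ 2 = fst z ^ 2 + snd z ^ 2).
now rewrite !pow2_abs.
Qed.

Lemma path_deriv_is_derive g t d :
  is_path_deriv g t d <-> is_derive (K := R_AbsRing) (V := C_R_NormedModule) g t d.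
Proof.
assert (E : forall s, norm (K := R_AbsRing) (V := C_R_NormedModule)
    (minus (minus (g s) (g t)) (scal (V := C_R_NormedModule) (minus s t) d))
  = Cmod (g s - g t - RtoC (s - t) * d)%C).
{ intros s. rewrite <- scal_R_Cmult. exact (norm_C_R _). }
split.
- intros H; split.
  + apply (is_linear_scal_l (V := C_R_NormedModule)).
  + intros x Hx.
    apply (is_filter_lim_locally_unique (V := AbsRing_NormedModule R_AbsRing)) in Hx. subst x.
    intros [eps He]. destruct (H eps He) as [e [Hd Hw]].
    exists (mkposreal e Hd). intros y Hy.
    exact (Rle_trans _ _ _ (Req_le _ _ (E y)) (Hw y Hy)).
- intros [_ H] eps He.
  destruct (H t (fun P HP => HP) (mkposreal eps He)) as [[e Hd] Hw].
  exists e; split; [exact Hd|]. intros w Hy.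
  exact (Rle_trans _ _ _ (Req_le _ _ (eq_sym (E w))) (Hw w Hy)).
Qed.

Lemma path_deriv_ext f g t l : (forall w, f w = g w) -> is_path_deriv f t l -> is_path_deriv g t l.
Proof.
intros E H eps He. destruct (H eps He) as [e [? Hw]]. exists e; split; [easy|].
intros s Hs. rewrite <- !E. now apply Hw.
Qed.

Lemma path_deriv_comp F g t l d :
  is_cderiv F (g t) l -> is_path_deriv g t d -> is_path_deriv (fun s => F (g s)) t (l * d).
Proof.
intros HF Hg eps He.
set (K := Cmod d + 1). assert (HK : 0 < K) by (unfold K; pose proof (Cmod_ge_0 d); lra).
set (L := Cmod l + 1). assert (HL : 0 < L) by (unfold L; pose proof (Cmod_ge_0 l); lra).
destruct (HF (eps / (2 * K))) as [d1 [Hd1 H1]]. { apply Rdiv_lt_0_compat; lra. }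
destruct (Hg (Rmin 1 (eps / (2 * L)))) as [d2 [Hd2 H2]].
{ apply Rmin_case; [lra|]. apply Rdiv_lt_0_compat; lra. }
exists (Rmin d2 (d1 / K)); split.
{ apply Rmin_case; [lra|]. now apply Rdiv_lt_0_compat. }
intros s Hs.
assert (Hs2 : Rabs (s - t) < d2) by (apply Rlt_le_trans with (1 := Hs), Rmin_l).
assert (Hs1 : Rabs (s - t) * K < d1).
{ apply Rmult_lt_reg_r with (/ K); [now apply Rinv_0_lt_compat|].
  rewrite Rmult_assoc, Rinv_r, Rmult_1_r by lra.
  apply Rlt_le_trans with (1 := Hs), Rmin_r. }
specialize (H2 s Hs2). pose proof (Rabs_pos (s - t)) as Hp.
assert (Hgs : Cmod (g s - g t) <= K * Rabs (s - t)).
{ replace (g s - g t)%C with ((g s - g t - RtoC (s - t) * d) + RtoC (s - t) * d)%C by ring.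
  eapply Rle_trans; [apply Cmod_triangle|]. rewrite Cmod_mult, Cmod_R. unfold K.
  pose proof (Rmin_l 1 (eps / (2 * L))). nra. }
assert (H1' := H1 (g s) ltac:(lra)).
replace (F (g s) - F (g t) - RtoC (s - t) * (l * d))%C with
  ((F (g s) - F (g t) - l * (g s - g t)) + l * (g s - g t - RtoC (s - t) * d))%C by ring.
eapply Rle_trans; [apply Cmod_triangle|]. rewrite Cmod_mult.
assert (A1 : eps / (2 * K) * Cmod (g s - g t) <= eps / 2 * Rabs (s - t)).
{ apply Rle_trans with (eps / (2 * K) * (K * Rabs (s - t))).
  - apply Rmult_le_compat_l; [|exact Hgs]. apply Rlt_le, Rdiv_lt_0_compat; lra.
  - right; field; lra. }
assert (A2 : Cmod l * Cmod (g s - g t - RtoC (s - t) * d) <= eps / 2 * Rabs (s - t)).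
{ apply Rle_trans with (L * (eps / (2 * L) * Rabs (s - t))).
  - apply Rmult_le_compat; try apply Cmod_ge_0; [unfold L; lra|].
    eapply Rle_trans; [exact H2|]. apply Rmult_le_compat_r; [easy|apply Rmin_r].
  - right; field; lra. }
lra.
Qed.

Lemma path_deriv_affine p q t : is_path_deriv (fun s => p + RtoC s * q)%C t q.
Proof.
intros eps He; exists 1; split; [lra|]. intros s _.
replace (p + s * q - (p + t * q) - (s - t)%R * q)%C with (RtoC 0) by (rewrite RtoC_minus; ring).
rewrite Cmod_0. pose proof (Rabs_pos (s - t)); nra.
Qed.

Lemma path_deriv_pair (f g : R -> R) t a b :
  is_derive f t a -> is_derive g t b -> is_path_deriv (fun s => (f s, g s)) t (a, b).
Proof.
intros Hf Hg eps He.
destruct Hf as [_ Hf]. destruct Hg as [_ Hg].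
assert (He2 : 0 < eps / 2) by lra.
destruct (Hf t (fun P HP => HP) (mkposreal _ He2)) as [[d1 Hd1] H1].
destruct (Hg t (fun P HP => HP) (mkposreal _ He2)) as [[d2 Hd2] H2].
exists (Rmin d1 d2); split; [now apply Rmin_case|].
intros s Hs.
specialize (H1 s (Rlt_le_trans _ _ _ Hs (Rmin_l _ _))).
specialize (H2 s (Rlt_le_trans _ _ _ Hs (Rmin_r _ _))).
change (Rabs (f s - f t - (s - t) * a) <= eps / 2 * Rabs (s - t)) in H1.
change (Rabs (g s - g t - (s - t) * b) <= eps / 2 * Rabs (s - t)) in H2.
eapply Rle_trans; [apply Cmod_le_abs|]. simpl.
replace (f s + - f t + - ((s - t) * a - 0 * b)) with (f s - f t - (s - t) * a) by ring.
replace (g s + - g t + - ((s - t) * b + 0 * a)) with (g s - g t - (s - t) * b) by ring.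
lra.
Qed.

(** Continuity for the product topology of [C], the one that integration theory expects. *)
Definition path_cont (g : R -> C) (t : R) : Prop :=
  continuous (T := R_UniformSpace) (U := C_UniformSpace) g t.

Lemma path_cont_eps g t : path_cont g t <->
  forall eps, 0 < eps -> exists e, 0 < e /\ forall s, Rabs (s - t) < e -> Cmod (g s - g t) < eps.
Proof.
split.
- intros H eps He. assert (He2 : 0 < eps / 2) by lra.
  destruct (H (ball (g t) (mkposreal _ He2))) as [[e Hd] Hw].
  { now exists (mkposreal _ He2). }
  exists e; split; [exact Hd|]. intros s Hs. destruct (Hw s Hs) as [A B].
  eapply Rle_lt_trans; [apply Cmod_le_abs|].
  change (Rabs (fst (g s) - fst (g t)) < eps / 2) in A.
  change (Rabs (snd (g s) - snd (g t)) < eps / 2) in B. simpl. unfold Rminus in *. lra.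
- intros H P [[eps He] HP]. destruct (H eps He) as [e [Hd Hw]].
  exists (mkposreal e Hd). intros s Hs. apply HP. specialize (Hw s Hs).
  assert (M := Rmax_Cmod (g s - g t)%C).
  split.
  + change (Rabs (fst (g s) - fst (g t)) < eps).
    eapply Rle_lt_trans; [|exact Hw]. eapply Rle_trans; [|exact M]. apply Rmax_l.
  + change (Rabs (snd (g s) - snd (g t)) < eps).
    eapply Rle_lt_trans; [|exact Hw]. eapply Rle_trans; [|exact M]. apply Rmax_r.
Qed.

Lemma path_deriv_cont g t d : is_path_deriv g t d -> path_cont g t.
Proof.
intros H. apply (ex_derive_continuous (K := R_AbsRing) (V := C_R_NormedModule)).
exists d. now apply path_deriv_is_derive.
Qed.

Lemma path_cont_pair (f g : R -> R) t :
  continuous f t -> continuous g t -> path_cont (fun s => (f s, g s)) t.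
Proof.
intros Hf Hg. apply (filterlim_comp_2 (F := locally t) f g (fun a b => (a, b)) Hf Hg).
intros P [e He]. exists (ball (f t) e) (ball (g t) e).
- now exists e.
- now exists e.
- intros a b Ha Hb. apply He. now split.
Qed.

Lemma path_cont_Re g t : path_cont g t -> continuous (fun s => fst (g s)) t.
Proof.
intros H. apply continuous_comp with (g := fst); [exact H|].
rewrite (surjective_pairing (g t)). apply continuous_fst.
Qed.

Lemma path_cont_Im g t : path_cont g t -> continuous (fun s => snd (g s)) t.
Proof.
intros H. apply continuous_comp with (g := snd); [exact H|].
rewrite (surjective_pairing (g t)). apply continuous_snd.
Qed.

Lemma path_cont_const c t : path_cont (fun _ => c) t.
Proof. apply continuous_const. Qed.

Lemma path_cont_plus f g t : path_cont f t -> path_cont g t -> path_cont (fun s => f s + g s)%C t.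
Proof.
apply (continuous_plus (K := R_AbsRing) (V := C_R_NormedModule)).
Qed.

Lemma path_cont_mult f g t : path_cont f t -> path_cont g t -> path_cont (fun s => f s * g s)%C t.
Proof.
intros Hf Hg. apply path_cont_pair.
- apply (continuous_minus (V := R_NormedModule)); apply (continuous_mult (K := R_AbsRing));
  now (apply path_cont_Re || apply path_cont_Im).
- apply (continuous_plus (V := R_NormedModule)); apply (continuous_mult (K := R_AbsRing));
  now (apply path_cont_Re || apply path_cont_Im).
Qed.

Lemma path_cont_minus f g t : path_cont f t -> path_cont g t -> path_cont (fun s => f s - g s)%C t.
Proof.
apply (continuous_minus (V := C_R_NormedModule)).
Qed.

Lemma path_cont_comp F g t l : is_cderiv F (g t) l -> path_cont g t -> path_cont (fun s => F (g s)) t.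
Proof.
intros HF Hg. apply path_cont_eps. intros eps He.
destruct (cderiv_cont _ _ _ HF eps He) as [d [Hd H]].
destruct (proj1 (path_cont_eps g t) Hg d Hd) as [e [He' H']].
exists e; split; [exact He'|]. intros s Hs. apply H, H', Hs.
Qed.

Lemma path_cont_pow g n t : path_cont g t -> path_cont (fun s => g s ^ n)%C t.
Proof.
intros H. apply (path_cont_comp (fun w => w ^ n)%C g t _ (cderiv_pow n (g t)) H).
Qed.

(** * Integrals of complex functions of a real variable *)

(** [C] is taken as a real normed module here, because the variable of integration is real. *)
Definition is_CInt (f : R -> C) (a b : R) (I : C) : Prop :=
  is_RInt (V := C_R_NormedModule) f a b I.

Definition CInt (f : R -> C) (a b : R) : C := RInt (V := C_R_CompleteNormedModule) f a b.

Lemma is_CInt_unique f a b I : is_CInt f a b I -> CInt f a b = I.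
Proof. intros H. exact (is_RInt_unique (V := C_R_CompleteNormedModule) f a b I H). Qed.

Lemma CInt_correct f a b :
  (forall t, Rmin a b <= t <= Rmax a b -> path_cont f t) -> is_CInt f a b (CInt f a b).
Proof.
intros H. apply (RInt_correct (V := C_R_CompleteNormedModule)).
now apply ex_RInt_continuous.
Qed.

Lemma is_CInt_ext f g a b I :
  (forall t, Rmin a b < t < Rmax a b -> f t = g t) -> is_CInt f a b I -> is_CInt g a b I.
Proof. apply is_RInt_ext. Qed.

Lemma is_CInt_plus f g a b I J :
  is_CInt f a b I -> is_CInt g a b J -> is_CInt (fun t => f t + g t)%C a b (I + J).
Proof. apply (is_RInt_plus (V := C_R_NormedModule)). Qed.

Lemma is_CInt_minus f g a b I J :
  is_CInt f a b I -> is_CInt g a b J -> is_CInt (fun t => f t - g t)%C a b (I - J).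
Proof. apply (is_RInt_minus (V := C_R_NormedModule)). Qed.

Lemma is_CInt_Chasles f a b c I J :
  is_CInt f a b I -> is_CInt f b c J -> is_CInt f a c (I + J).
Proof. apply (is_RInt_Chasles (V := C_R_NormedModule)). Qed.

Lemma is_CInt_Re f a b I : is_CInt f a b I ->
  is_RInt (V := R_NormedModule) (fun t => fst (f t)) a b (fst I).
Proof. apply is_RInt_fct_extend_fst. Qed.

Lemma is_CInt_Im f a b I : is_CInt f a b I ->
  is_RInt (V := R_NormedModule) (fun t => snd (f t)) a b (snd I).
Proof. apply is_RInt_fct_extend_snd. Qed.

Lemma is_CInt_scal c f a b I : is_CInt f a b I -> is_CInt (fun t => c * f t)%C a b (c * I).
Proof.
intros H. assert (H1 := is_CInt_Re _ _ _ _ H). assert (H2 := is_CInt_Im _ _ _ _ H).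
apply (is_RInt_fct_extend_pair (U := R_NormedModule) (V := R_NormedModule)); simpl.
- apply (is_RInt_minus (V := R_NormedModule)); now apply (is_RInt_scal (V := R_NormedModule)).
- apply (is_RInt_plus (V := R_NormedModule)); now apply (is_RInt_scal (V := R_NormedModule)).
Qed.

Lemma is_CInt_bound f a b I M :
  a <= b -> (forall t, a <= t <= b -> Cmod (f t) <= M) -> is_CInt f a b I -> Cmod I <= (b - a) * M.
Proof.
intros Hab H HI. rewrite <- norm_C_R.
apply (norm_RInt_le_const (V := C_R_NormedModule) f a b); [easy| |exact HI].
intros x Hx. rewrite norm_C_R. now apply H.
Qed.

Lemma is_CInt_FTC g d a b :
  (forall t, Rmin a b <= t <= Rmax a b -> is_path_deriv g t (d t)) ->
  (forall t, Rmin a b <= t <= Rmax a b -> path_cont d t) ->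
  is_CInt d a b (g b - g a).
Proof.
intros H1 H2. apply (is_RInt_derive (V := C_R_CompleteNormedModule) g d); [|exact H2].
intros x Hx. apply path_deriv_is_derive. now apply H1.
Qed.

Lemma is_CInt_const c a b : is_CInt (fun _ => c) a b (RtoC (b - a) * c).
Proof.
rewrite <- scal_R_Cmult. apply (is_RInt_const (V := C_R_NormedModule)).
Qed.

(** * Goursat's lemma for the image of a square *)

Section Goursat.

Variables (phi phi1 phi2 : R -> R -> C) (K : R).

Hypothesis HK : 0 < K.
Hypothesis der1 : forall x y, 0 <= x <= 1 -> 0 <= y <= 1 -> is_path_deriv (fun s => phi s y) x (phi1 x y).
Hypothesis der2 : forall x y, 0 <= x <= 1 -> 0 <= y <= 1 -> is_path_deriv (fun s => phi x s) y (phi2 x y).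
Hypothesis cont1 : forall x y, 0 <= x <= 1 -> 0 <= y <= 1 -> path_cont (fun s => phi1 s y) x.
Hypothesis cont2 : forall x y, 0 <= x <= 1 -> 0 <= y <= 1 -> path_cont (fun s => phi2 x s) y.
Hypothesis bound1 : forall x y, 0 <= x <= 1 -> 0 <= y <= 1 -> Cmod (phi1 x y) <= K.
Hypothesis bound2 : forall x y, 0 <= x <= 1 -> 0 <= y <= 1 -> Cmod (phi2 x y) <= K.

Definition holo_on_image (G : C -> C) : Prop :=
  forall x y, 0 <= x <= 1 -> 0 <= y <= 1 -> exists l, is_cderiv G (phi x y) l.

Definition hor_edge (G : C -> C) (y a b : R) : C := CInt (fun x => G (phi x y) * phi1 x y)%C a b.
Definition ver_edge (G : C -> C) (x a b : R) : C := CInt (fun y => G (phi x y) * phi2 x y)%C a b.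

Definition boundary_integral (G : C -> C) (x y h : R) : C :=
  (hor_edge G y x (x + h) + ver_edge G (x + h) y (y + h)
   - hor_edge G (y + h) x (x + h) - ver_edge G x y (y + h))%C.

Lemma hor_edge_correct G y a b :
  holo_on_image G -> 0 <= y <= 1 -> 0 <= a <= b -> b <= 1 ->
  is_CInt (fun x => G (phi x y) * phi1 x y)%C a b (hor_edge G y a b).
Proof.
intros HG Hy Ha Hb. apply CInt_correct. rewrite Rmin_left, Rmax_right by lra.
intros t Ht. apply path_cont_mult.
- destruct (HG t y) as [l Hl]; try lra.
  apply (path_cont_comp G (fun x => phi x y) t l Hl).
  apply path_deriv_cont with (phi1 t y). apply der1; lra.
- apply cont1; lra.
Qed.

Lemma ver_edge_correct G x a b :
  holo_on_image G -> 0 <= x <= 1 -> 0 <= a <= b -> b <= 1 ->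
  is_CInt (fun y => G (phi x y) * phi2 x y)%C a b (ver_edge G x a b).
Proof.
intros HG Hy Ha Hb. apply CInt_correct. rewrite Rmin_left, Rmax_right by lra.
intros t Ht. apply path_cont_mult.
- destruct (HG x t) as [l Hl]; try lra.
  apply (path_cont_comp G (fun y => phi x y) t l Hl).
  apply path_deriv_cont with (phi2 x t). apply der2; lra.
- apply cont2; lra.
Qed.

Lemma hor_edge_split G y a b c :
  holo_on_image G -> 0 <= y <= 1 -> 0 <= a <= b -> b <= c -> c <= 1 ->
  hor_edge G y a c = (hor_edge G y a b + hor_edge G y b c)%C.
Proof.
intros. apply is_CInt_unique. apply is_CInt_Chasles with b; apply hor_edge_correct; auto; lra.
Qed.

Lemma ver_edge_split G y a b c :
  holo_on_image G -> 0 <= y <= 1 -> 0 <= a <= b -> b <= c -> c <= 1 ->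
  ver_edge G y a c = (ver_edge G y a b + ver_edge G y b c)%C.
Proof.
intros. apply is_CInt_unique. apply is_CInt_Chasles with b; apply ver_edge_correct; auto; lra.
Qed.

Lemma boundary_split G x y h :
  holo_on_image G -> 0 <= x -> 0 <= y -> 0 <= h -> x + 2 * h <= 1 -> y + 2 * h <= 1 ->
  boundary_integral G x y (2 * h) =
    (boundary_integral G x y h + boundary_integral G (x + h) y h
     + (boundary_integral G x (y + h) h + boundary_integral G (x + h) (y + h) h))%C.
Proof.
intros. unfold boundary_integral.
replace (x + h + h) with (x + 2 * h) by ring. replace (y + h + h) with (y + 2 * h) by ring.
rewrite (hor_edge_split G y x (x + h) (x + 2 * h)) by (auto; lra).
rewrite (hor_edge_split G (y + 2 * h) x (x + h) (x + 2 * h)) by (auto; lra).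
rewrite (ver_edge_split G x y (y + h) (y + 2 * h)) by (auto; lra).
rewrite (ver_edge_split G (x + 2 * h) y (y + h) (y + 2 * h)) by (auto; lra).
ring.
Qed.

(** An affine integrand has a holomorphic primitive, so its integral along a path only depends
    on the end points. *)
Lemma edge_affine (g d : R -> C) A B a b :
  a <= b -> (forall t, a <= t <= b -> is_path_deriv g t (d t)) ->
  (forall t, a <= t <= b -> path_cont d t) ->
  is_CInt (fun t => (A + B * g t) * d t)%C a b
    ((A * g b + B / 2 * (g b * g b)) - (A * g a + B / 2 * (g a * g a))).
Proof.
intros Hab Hd Hc.
apply (is_CInt_FTC (fun t => A * g t + B / 2 * (g t * g t))%C); rewrite Rmin_left, Rmax_right by easy.
- intros t Ht.
  apply (path_deriv_comp (fun w => A * w + B / 2 * (w * w))%C); [|now apply Hd].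
  replace (A + B * g t)%C with (A * 1 + B / 2 * (1 * g t + g t * 1))%C.
  2:{ field. }
  apply cderiv_plus; apply cderiv_scal; [apply cderiv_id|]. apply cderiv_mult; apply cderiv_id.
- intros t Ht. apply path_cont_mult; [|now apply Hc].
  apply path_cont_plus; [apply path_cont_const|]. apply path_cont_mult; [apply path_cont_const|].
  apply path_deriv_cont with (d t). now apply Hd.
Qed.

Lemma hor_edge_lipschitz y a b :
  0 <= y <= 1 -> 0 <= a <= b -> b <= 1 -> Cmod (phi b y - phi a y) <= (b - a) * K.
Proof.
intros Hy Ha Hb. apply (is_CInt_bound (fun x => phi1 x y) a b); [lra| |].
- intros; apply bound1; lra.
- apply (is_CInt_FTC (fun x => phi x y)); rewrite Rmin_left, Rmax_right by lra; intros.
  + apply der1; lra.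
  + apply cont1; lra.
Qed.

Lemma ver_edge_lipschitz x a b :
  0 <= x <= 1 -> 0 <= a <= b -> b <= 1 -> Cmod (phi x b - phi x a) <= (b - a) * K.
Proof.
intros Hy Ha Hb. apply (is_CInt_bound (fun y => phi2 x y) a b); [lra| |].
- intros; apply bound2; lra.
- apply (is_CInt_FTC (fun y => phi x y)); rewrite Rmin_left, Rmax_right by lra; intros.
  + apply der2; lra.
  + apply cont2; lra.
Qed.

Lemma phi_lipschitz x y x' y' :
  0 <= x <= 1 -> 0 <= y <= 1 -> 0 <= x' <= 1 -> 0 <= y' <= 1 ->
  Cmod (phi x y - phi x' y') <= (Rabs (x - x') + Rabs (y - y')) * K.
Proof.
intros.
replace (phi x y - phi x' y')%C with ((phi x y - phi x' y) + (phi x' y - phi x' y'))%C by ring.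
eapply Rle_trans; [apply Cmod_triangle|].
assert (Cmod (phi x y - phi x' y) <= Rabs (x - x') * K).
{ destruct (Rle_dec x x').
  - rewrite Cmod_minus_sym, Rabs_minus_sym, Rabs_pos_eq by lra. apply hor_edge_lipschitz; lra.
  - rewrite Rabs_pos_eq by lra. apply hor_edge_lipschitz; lra. }
assert (Cmod (phi x' y - phi x' y') <= Rabs (y - y') * K).
{ destruct (Rle_dec y y').
  - rewrite Cmod_minus_sym, Rabs_minus_sym, Rabs_pos_eq by lra. apply ver_edge_lipschitz; lra.
  - rewrite Rabs_pos_eq by lra. apply ver_edge_lipschitz; lra. }
lra.
Qed.

(** The contributions of [A + B w] along the four edges cancel, so only the deviation of [G]
    from this affine function is integrated.  With the differential of [G] at a point of a small
    square as affine function, [M] is of smaller order than [h]. *)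
Lemma boundary_affine_bound G x y h A B M :
  holo_on_image G -> 0 <= x -> 0 <= y -> 0 <= h -> x + h <= 1 -> y + h <= 1 ->
  (forall s t, x <= s <= x + h -> y <= t <= y + h ->
     Cmod (G (phi s t) - (A + B * phi s t)) <= M) ->
  Cmod (boundary_integral G x y h) <= 4 * (h * (M * K)).
Proof.
intros HG Hx Hy Hh Hxh Hyh HM.
assert (HM0 : 0 <= M).
{ eapply Rle_trans; [apply Cmod_ge_0|]. apply (HM x y); lra. }
set (P := fun w => (A * w + B / 2 * (w * w))%C).
assert (Hor : forall t, y <= t <= y + h ->
  Cmod (hor_edge G t x (x + h) - (P (phi (x + h) t) - P (phi x t))) <= h * (M * K)).
{ intros t Ht.
  replace h with ((x + h) - x) at 3 by ring.
  apply (is_CInt_bound (fun s => G (phi s t) * phi1 s t - (A + B * phi s t) * phi1 s t)%C); [lra| |].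
  - intros s Hs.
    replace (G (phi s t) * phi1 s t - (A + B * phi s t) * phi1 s t)%C
      with ((G (phi s t) - (A + B * phi s t)) * phi1 s t)%C by ring.
    rewrite Cmod_mult. apply Rmult_le_compat; try apply Cmod_ge_0.
    + apply HM; lra.
    + apply bound1; lra.
  - apply is_CInt_minus; [apply hor_edge_correct; auto; lra|].
    apply (edge_affine (fun s => phi s t) (fun s => phi1 s t)); [lra| |]; intros.
    + apply der1; lra.
    + apply cont1; lra. }
assert (Ver : forall s, x <= s <= x + h ->
  Cmod (ver_edge G s y (y + h) - (P (phi s (y + h)) - P (phi s y))) <= h * (M * K)).
{ intros s Hs.
  replace h with ((y + h) - y) at 3 by ring.
  apply (is_CInt_bound (fun t => G (phi s t) * phi2 s t - (A + B * phi s t) * phi2 s t)%C); [lra| |].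
  - intros t Ht.
    replace (G (phi s t) * phi2 s t - (A + B * phi s t) * phi2 s t)%C
      with ((G (phi s t) - (A + B * phi s t)) * phi2 s t)%C by ring.
    rewrite Cmod_mult. apply Rmult_le_compat; try apply Cmod_ge_0.
    + apply HM; lra.
    + apply bound2; lra.
  - apply is_CInt_minus; [apply ver_edge_correct; auto; lra|].
    apply (edge_affine (fun t => phi s t) (fun t => phi2 s t)); [lra| |]; intros.
    + apply der2; lra.
    + apply cont2; lra. }
assert (H1 := Hor y ltac:(lra)). assert (H2 := Hor (y + h) ltac:(lra)).
assert (H3 := Ver x ltac:(lra)). assert (H4 := Ver (x + h) ltac:(lra)).
unfold boundary_integral.
match type of H1 with Cmod ?u <= _ => set (u1 := u) in * end.
match type of H2 with Cmod ?u <= _ => set (u2 := u) in * end.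
match type of H3 with Cmod ?u <= _ => set (u3 := u) in * end.
match type of H4 with Cmod ?u <= _ => set (u4 := u) in * end.
match goal with |- Cmod ?u <= _ => replace u with ((u1 + u4) - (u2 + u3))%C end.
2:{ unfold u1, u2, u3, u4. ring. }
eapply Rle_trans; [apply Cmod_triangle_minus|].
pose proof (Cmod_triangle u1 u4). pose proof (Cmod_triangle u2 u3). lra.
Qed.

(** The scaling that bisection preserves: boundary integrals add up over the four quarters while
    areas are divided by four, so one of the quarters is heavy again. *)
Definition heavy_square (G : C -> C) (eps : R) (h : R) (p : R * R) : Prop :=
  0 <= fst p /\ fst p + h <= 1 /\ 0 <= snd p /\ snd p + h <= 1 /\
  eps * h ^ 2 <= Cmod (boundary_integral G (fst p) (snd p) h).

Lemma heavy_square_quarter G eps h p :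
  holo_on_image G -> 0 <= h -> heavy_square G eps (2 * h) p ->
  exists q, heavy_square G eps h q /\ fst p <= fst q /\ fst q + h <= fst p + 2 * h /\
            snd p <= snd q /\ snd q + h <= snd p + 2 * h.
Proof.
intros HG Hh [H1 [H2 [H3 [H4 H5]]]].
destruct p as [x y]; simpl in *.
rewrite boundary_split in H5 by (auto; lra).
assert (T : forall a b c d : C, eps * (2 * h * (2 * h * 1)) <= Cmod (a + b + (c + d)) ->
  eps * h ^ 2 <= Cmod a \/ eps * h ^ 2 <= Cmod b \/ eps * h ^ 2 <= Cmod c \/ eps * h ^ 2 <= Cmod d).
{ intros a b c d H.
  pose proof (Cmod_triangle (a + b) (c + d)). pose proof (Cmod_triangle a b).
  pose proof (Cmod_triangle c d).
  destruct (Rle_dec (eps * h ^ 2) (Cmod a)); [now left|].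
  destruct (Rle_dec (eps * h ^ 2) (Cmod b)); [now right; left|].
  destruct (Rle_dec (eps * h ^ 2) (Cmod c)); [now right; right; left|].
  destruct (Rle_dec (eps * h ^ 2) (Cmod d)); [now right; right; right|].
  exfalso. simpl in *. nra. }
destruct (T _ _ _ _ H5) as [H|[H|[H|H]]].
- exists (x, y); unfold heavy_square; simpl. repeat split; try lra; exact H.
- exists (x + h, y); unfold heavy_square; simpl. repeat split; try lra; exact H.
- exists (x, y + h); unfold heavy_square; simpl. repeat split; try lra; exact H.
- exists (x + h, y + h); unfold heavy_square; simpl. repeat split; try lra; exact H.
Qed.

End Goursat.

Lemma nested_halves (u : nat -> R) :
  (forall n, u n <= u (S n)) -> (forall n, u (S n) + (/ 2) ^ S n <= u n + (/ 2) ^ n) ->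
  exists l, forall n, u n <= l <= u n + (/ 2) ^ n.
Proof.
intros H1 H2.
assert (M1 : forall n k, u n <= u (n + k)%nat).
{ intros n; induction k; [rewrite Nat.add_0_r; lra|].
  rewrite <- plus_n_Sm. eapply Rle_trans; [exact IHk|apply H1]. }
assert (M2 : forall n k, u (n + k)%nat + (/ 2) ^ (n + k) <= u n + (/ 2) ^ n).
{ intros n; induction k; [rewrite Nat.add_0_r; lra|].
  rewrite <- plus_n_Sm. eapply Rle_trans; [apply H2|exact IHk]. }
assert (P : forall n, 0 < (/ 2) ^ n) by (intros; apply pow_lt; lra).
assert (B : forall n m, u m <= u n + (/ 2) ^ n).
{ intros n m. destruct (Nat.le_ge_cases n m) as [L|L].
  - replace m with (n + (m - n))%nat by lia. pose proof (M2 n (m - n)%nat).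
    pose proof (P (n + (m - n))%nat). lra.
  - replace n with (m + (n - m))%nat by lia. pose proof (M1 m (n - m)%nat).
    pose proof (P (m + (n - m))%nat). lra. }
destruct (completeness (fun v => exists n, v = u n)) as [l [Hl1 Hl2]].
- exists (u 0%nat + (/ 2) ^ 0). intros v [n ->]. apply B.
- exists (u 0%nat). now exists 0%nat.
- exists l. intros n; split.
  + apply Hl1. now exists n.
  + apply Hl2. intros v [m ->]. apply B.
Qed.

(** If the boundary integral were not zero, bisection would give nested squares of side [2^-n] on
    which it is at least [eps 4^-n].  At their common point [G] is differentiable, and
    [boundary_affine_bound] makes the integral [o(4^-n)]. *)
Lemma goursat (phi phi1 phi2 : R -> R -> C) (K : R) (G : C -> C) :
  0 < K ->
  (forall x y, 0 <= x <= 1 -> 0 <= y <= 1 -> is_path_deriv (fun s => phi s y) x (phi1 x y)) ->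
  (forall x y, 0 <= x <= 1 -> 0 <= y <= 1 -> is_path_deriv (fun s => phi x s) y (phi2 x y)) ->
  (forall x y, 0 <= x <= 1 -> 0 <= y <= 1 -> path_cont (fun s => phi1 s y) x) ->
  (forall x y, 0 <= x <= 1 -> 0 <= y <= 1 -> path_cont (fun s => phi2 x s) y) ->
  (forall x y, 0 <= x <= 1 -> 0 <= y <= 1 -> Cmod (phi1 x y) <= K) ->
  (forall x y, 0 <= x <= 1 -> 0 <= y <= 1 -> Cmod (phi2 x y) <= K) ->
  holo_on_image phi G ->
  boundary_integral phi phi1 phi2 G 0 0 1 = 0%C.
Proof.
intros HK der1 der2 cont1 cont2 bound1 bound2 HG.
destruct (Ceq_dec (boundary_integral phi phi1 phi2 G 0 0 1) 0) as [E|NE]; [exact E|exfalso].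
apply Cmod_gt_0 in NE. set (eps := Cmod (boundary_integral phi phi1 phi2 G 0 0 1)) in NE.
set (gd := heavy_square phi phi1 phi2 G eps).
assert (Step : forall n (p : {p : R * R | gd ((/ 2) ^ n) p}),
  {q : {q : R * R | gd ((/ 2) ^ S n) q} |
     fst (proj1_sig p) <= fst (proj1_sig q) /\
     fst (proj1_sig q) + (/ 2) ^ S n <= fst (proj1_sig p) + (/ 2) ^ n /\
     snd (proj1_sig p) <= snd (proj1_sig q) /\
     snd (proj1_sig q) + (/ 2) ^ S n <= snd (proj1_sig p) + (/ 2) ^ n}).
{ intros n [p Hp]. apply ClassicalEpsilon.constructive_indefinite_description.
  assert (E : (/ 2) ^ n = 2 * (/ 2) ^ S n) by (simpl; field).
  assert (Hp' := Hp). rewrite E in Hp'.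
  destruct (heavy_square_quarter phi phi1 phi2 der1 der2 cont1 cont2 G eps ((/ 2) ^ S n) p HG)
    as [q [Hq Hq']]; [apply pow_le; lra|exact Hp'|].
  exists (exist _ q Hq). cbn [proj1_sig]. rewrite E. exact Hq'. }
assert (H0 : gd ((/ 2) ^ 0) (0, 0)).
{ unfold gd, heavy_square; simpl. repeat split; try lra. unfold eps. lra. }
pose (sq := fix sq (n : nat) : {p : R * R | gd ((/ 2) ^ n) p} :=
  match n with
  | O => exist _ (0, 0) H0
  | S m => proj1_sig (Step m (sq m))
  end).
assert (Hsq : forall n, _) by (intros n; exact (proj2_sig (Step n (sq n)))).
set (x := fun n => fst (proj1_sig (sq n))). set (y := fun n => snd (proj1_sig (sq n))).
destruct (nested_halves x) as [a Ha]; try (intros n; apply (Hsq n)).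
destruct (nested_halves y) as [b Hb]; try (intros n; apply (Hsq n)).
assert (Hgd : forall n, gd ((/ 2) ^ n) (x n, y n)).
{ intros n. unfold x, y. rewrite <- surjective_pairing. exact (proj2_sig (sq n)). }
assert (Ha0 := Ha 0%nat). assert (Hb0 := Hb 0%nat). unfold x, y in Ha0, Hb0; simpl in Ha0, Hb0.
destruct (HG a b) as [l Hl]; try lra.
(* Points of a square of side [h] are within [2 K h] of [phi a b], and the four edges have total
   length at most [4 K h]; with this accuracy the boundary integral is at most [eps / 2 * h^2]. *)
destruct (Hl (eps / (16 * K ^ 2))) as [d [Hd Hld]].
{ apply Rdiv_lt_0_compat; [easy|]. pose proof (pow_lt K 2 HK). lra. }
destruct (pow_lt_1_zero (/ 2)) with (y := d / (2 * K)) as [N HN].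
{ rewrite Rabs_pos_eq; lra. }
{ apply Rdiv_lt_0_compat; lra. }
specialize (HN N (le_n N)). rewrite Rabs_pos_eq in HN by (apply pow_le; lra).
destruct (Hgd N) as [G1 [G2 [G3 [G4 G5]]]]; simpl fst in *; simpl snd in *.
set (h := (/ 2) ^ N) in *. assert (Hh : 0 < h) by (apply pow_lt; lra).
assert (HaN := Ha N). assert (HbN := Hb N). fold h in HaN, HbN.
assert (HN' : 2 * K * h < d).
{ apply Rmult_lt_reg_r with (/ (2 * K)); [apply Rinv_0_lt_compat; lra|].
  replace (2 * K * h * / (2 * K)) with h by (field; lra). exact HN. }
assert (Bd := boundary_affine_bound phi phi1 phi2 K der1 der2 cont1 cont2 bound1 bound2
  G (x N) (y N) h (G (phi a b) - l * phi a b) l (eps / (16 * K ^ 2) * (2 * K * h)) HG G1 G3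
  ltac:(lra) G2 G4).
assert (Hlt : 4 * (h * (eps / (16 * K ^ 2) * (2 * K * h) * K)) = eps / 2 * h ^ 2).
{ field. lra. }
rewrite Hlt in Bd.
assert (Hfin : eps * h ^ 2 <= eps / 2 * h ^ 2).
{ eapply Rle_trans; [exact G5|]. apply Bd. intros s t Hs Ht.
  assert (Lip : Cmod (phi s t - phi a b) <= 2 * K * h).
  { eapply Rle_trans.
    - apply (phi_lipschitz phi phi1 phi2 K der1 der2 cont1 cont2 bound1 bound2); lra.
    - assert (Rabs (s - a) <= h) by (apply Rabs_le; lra).
      assert (Rabs (t - b) <= h) by (apply Rabs_le; lra). nra. }
  replace (G (phi s t) - (G (phi a b) - l * phi a b + l * phi s t))%C
    with (G (phi s t) - G (phi a b) - l * (phi s t - phi a b))%C by ring.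
  eapply Rle_trans; [apply Hld; lra|].
  apply Rmult_le_compat_l; [|exact Lip].
  apply Rlt_le, Rdiv_lt_0_compat; [easy|]. pose proof (pow_lt K 2 HK). lra. }
pose proof (pow_lt h 2 Hh). nra.
Qed.

(** * Integrals over circles *)

Definition unit_circle (y : R) : C := (cos (2 * PI * y), sin (2 * PI * y)).

Lemma Cmod_unit_circle y : Cmod (unit_circle y) = 1.
Proof.
unfold Cmod, unit_circle; simpl fst; simpl snd.
rewrite <- sqrt_1. f_equal. pose proof (sin2_cos2 (2 * PI * y)). unfold Rsqr in *. lra.
Qed.

Lemma unit_circle_neq_0 y : unit_circle y <> 0%C.
Proof. apply Cmod_gt_0. rewrite Cmod_unit_circle. lra. Qed.

Lemma unit_circle_1 : unit_circle 1 = unit_circle 0.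
Proof.
unfold unit_circle. rewrite Rmult_1_r, Rmult_0_r, cos_2PI, sin_2PI, cos_0, sin_0. reflexivity.
Qed.

Definition two_pi_i : C := (0, 2 * PI).

Lemma two_pi_i_neq_0 : two_pi_i <> 0%C.
Proof. intros H. injection H as H. pose proof PI_RGT_0. lra. Qed.

Lemma Cmod_two_pi_i : Cmod two_pi_i = 2 * PI.
Proof.
unfold Cmod, two_pi_i; simpl fst; simpl snd.
replace (0 ^ 2 + (2 * PI) ^ 2) with ((2 * PI) ^ 2) by ring.
apply sqrt_pow2. pose proof PI_RGT_0. lra.
Qed.

Lemma path_deriv_unit_circle y : is_path_deriv unit_circle y (two_pi_i * unit_circle y).
Proof.
replace (two_pi_i * unit_circle y)%C
  with ((- (2 * PI * sin (2 * PI * y)), 2 * PI * cos (2 * PI * y)) : C).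
2:{ unfold two_pi_i, unit_circle, Cmult; simpl. f_equal; ring. }
apply path_deriv_pair; auto_derive; trivial; ring.
Qed.

Lemma path_cont_unit_circle y : path_cont unit_circle y.
Proof. exact (path_deriv_cont _ _ _ (path_deriv_unit_circle y)). Qed.

(** The factor [2 i pi] of [dw = 2 i pi (r e) dy] is left out. *)
Definition circle_integral (G : C -> C) (c : C) (r : R) : C :=
  CInt (fun y => G (c + r * unit_circle y) * (r * unit_circle y))%C 0 1.

Lemma circle_integral_correct G (c : C) (r : R) :
  (forall y, 0 <= y <= 1 -> exists l, is_cderiv G (c + r * unit_circle y) l) ->
  is_CInt (fun y => G (c + r * unit_circle y) * (r * unit_circle y))%C 0 1 (circle_integral G c r).
Proof.
intros H. apply CInt_correct. rewrite Rmin_left, Rmax_right by lra. intros t Ht.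
assert (Hc : path_cont (fun y => r * unit_circle y)%C t).
{ apply path_cont_mult; [apply path_cont_const|apply path_cont_unit_circle]. }
destruct (H t Ht) as [l Hl].
apply path_cont_mult; [|exact Hc].
apply (path_cont_comp G (fun y => c + r * unit_circle y)%C t l Hl).
apply path_cont_plus; [apply path_cont_const|exact Hc].
Qed.

(** The two circles bound the image of the unit square under a map that is affine in [x] and
    winds once around a circle in [y].  The edges [y = 0] and [y = 1] have the same image and
    cancel.  Radius 0 is allowed, which gives Cauchy's theorem on disks. *)
Lemma circle_homotopy (G : C -> C) (c0 c1 : C) (r0 r1 : R) :
  (forall x y, 0 <= x <= 1 -> 0 <= y <= 1 ->
     exists l, is_cderiv G (c0 + x * (c1 - c0) + (r0 + x * (r1 - r0))%R * unit_circle y) l) ->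
  circle_integral G c0 r0 = circle_integral G c1 r1.
Proof.
intros HG.
set (phi := fun x y => (c0 + RtoC x * (c1 - c0) + RtoC (r0 + x * (r1 - r0)) * unit_circle y)%C).
set (phi1 := fun x y : R => (c1 - c0 + RtoC (r1 - r0) * unit_circle y)%C).
set (phi2 := fun x y => (RtoC (r0 + x * (r1 - r0)) * (two_pi_i * unit_circle y))%C).
set (K := Cmod (c1 - c0) + Rabs (r1 - r0) + (Rabs r0 + Rabs (r1 - r0)) * (2 * PI) + 1).
pose proof (Cmod_ge_0 (c1 - c0)). pose proof (Rabs_pos (r1 - r0)). pose proof (Rabs_pos r0).
pose proof PI_RGT_0.
assert (HK : 0 < K) by (unfold K; nra).
assert (E : boundary_integral phi phi1 phi2 G 0 0 1 = 0%C).
{ apply (goursat phi phi1 phi2 K G HK).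
  - intros x y _ _.
    apply path_deriv_ext with (fun s => (c0 + r0 * unit_circle y) +
      RtoC s * (c1 - c0 + RtoC (r1 - r0) * unit_circle y))%C.
    + intros s. unfold phi. rewrite RtoC_plus, RtoC_mult. ring.
    + apply path_deriv_affine.
  - intros x y _ _. unfold phi, phi2.
    set (P := (c0 + RtoC x * (c1 - c0))%C). set (Q := RtoC (r0 + x * (r1 - r0))).
    apply (path_deriv_comp (fun w => P + Q * w)%C unit_circle).
    + apply cderiv_affine.
    + apply path_deriv_unit_circle.
  - intros; apply path_cont_const.
  - intros; unfold phi2. apply path_cont_mult; [apply path_cont_const|].
    apply path_cont_mult; [apply path_cont_const|]. apply path_cont_unit_circle.
  - intros x y _ _. unfold phi1. eapply Rle_trans; [apply Cmod_triangle|].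
    rewrite Cmod_mult, Cmod_unit_circle, Cmod_R. unfold K. nra.
  - intros x y Hx _. unfold phi2. rewrite !Cmod_mult, Cmod_unit_circle, Cmod_R, Cmod_two_pi_i.
    assert (Rabs (r0 + x * (r1 - r0)) <= Rabs r0 + Rabs (r1 - r0)).
    { eapply Rle_trans; [apply Rabs_triang|]. rewrite Rabs_mult, (Rabs_pos_eq x) by lra. nra. }
    unfold K. nra.
  - exact HG. }
unfold boundary_integral in E. rewrite !Rplus_0_l in E.
assert (Eh : hor_edge phi phi1 G 1 0 1 = hor_edge phi phi1 G 0 0 1).
{ unfold hor_edge, phi, phi1. now rewrite unit_circle_1. }
assert (V : forall x c r, 0 <= x <= 1 -> c = (c0 + x * (c1 - c0))%C -> r = r0 + x * (r1 - r0) ->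
  ver_edge phi phi2 G x 0 1 = (two_pi_i * circle_integral G c r)%C).
{ intros x c r Hx -> ->. apply is_CInt_unique.
  apply is_CInt_ext with (fun y => two_pi_i *
    (G (c0 + x * (c1 - c0) + RtoC (r0 + x * (r1 - r0)) * unit_circle y)
      * (RtoC (r0 + x * (r1 - r0)) * unit_circle y)))%C.
  - intros t _. unfold phi, phi2. ring.
  - apply is_CInt_scal. apply circle_integral_correct. intros y Hy. now apply HG. }
rewrite Eh, (V 0 c0 r0), (V 1 c1 r1) in E; try lra; try ring.
assert (E2 : (two_pi_i * (circle_integral G c1 r1 - circle_integral G c0 r0))%C = 0%C).
{ rewrite <- E. ring. }
destruct (Ceq_dec (circle_integral G c0 r0) (circle_integral G c1 r1)) as [|N]; [easy|exfalso].
apply (Cmult_neq_0 two_pi_i (circle_integral G c1 r1 - circle_integral G c0 r0)%C); [| |exact E2].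
- apply two_pi_i_neq_0.
- apply Cminus_eq_contra. auto.
Qed.

Lemma cauchy_disk G (r : R) :
  0 <= r -> (forall z : C, Cmod z <= r -> exists l, is_cderiv G z l) -> circle_integral G 0 r = 0%C.
Proof.
intros Hr HG. rewrite (circle_homotopy G 0 0 r 0).
- apply is_CInt_unique. apply is_CInt_ext with (fun _ => 0%C).
  + intros t _. ring.
  + assert (H := is_CInt_const 0 0 1). rewrite Cmult_0_r in H. exact H.
- intros x y Hx Hy. apply HG.
  replace (0 + x * (0 - 0) + (r + x * (0 - r))%R * unit_circle y)%C
    with ((r + x * (0 - r))%R * unit_circle y)%C by ring.
  rewrite Cmod_mult, Cmod_unit_circle, Cmod_R, Rabs_pos_eq; nra.
Qed.

Section CauchyFormula.

Variables (f : C -> C) (rho : R).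
Hypothesis Hf : forall z, Cmod z < rho -> exists l, is_cderiv f z l.

(** The singularity of the difference quotient is removable: the circle of radius [r] around 0 can
    be moved to a circle around [z] of any small radius [t], on which the quotient is bounded, so
    that the integral is [O(t)]. *)
Lemma cauchy_quotient (z : C) (r : R) :
  Cmod z < r < rho -> circle_integral (fun w => (f w - f z) / (w - z))%C 0 r = 0%C.
Proof.
intros [Hz Hr]. pose proof (Cmod_ge_0 z) as Hz0. set (G := fun w => ((f w - f z) / (w - z))%C).
assert (HG : forall w : C, Cmod w < rho -> w <> z -> exists l, is_cderiv G w l).
{ intros w Hw Hne. destruct (Hf w Hw) as [l Hl]. eexists.
  apply (cderiv_div (fun w => f w - f z)%C (fun w => w - z)%C).
  - now apply Cminus_eq_contra.
  - apply cderiv_minus; [exact Hl|apply cderiv_const].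
  - apply cderiv_minus; [apply cderiv_id|apply cderiv_const]. }
destruct (Hf z) as [l Hl]; [lra|]. destruct (Hl 1) as [d [Hd Hld]]; [lra|].
set (e := Rmin (d / 2) (r - Cmod z)).
assert (He : 0 < e) by (apply Rmin_case; lra).
assert (He1 : e <= d / 2) by apply Rmin_l. assert (He2 : e <= r - Cmod z) by apply Rmin_r.
assert (Hsmall : forall t, 0 < t <= e ->
  Cmod (circle_integral G 0 r) <= t * (Cmod l + 1)).
{ intros t Ht.
  rewrite (circle_homotopy G 0 z r t).
  - replace (t * (Cmod l + 1)) with ((1 - 0) * (t * (Cmod l + 1))) by ring.
    assert (Hd0 : forall y, Cmod (z + t * unit_circle y - z) = t).
    { intros y. replace (z + t * unit_circle y - z)%C with (t * unit_circle y)%C by ring.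
      rewrite Cmod_mult, Cmod_unit_circle, Cmod_R, Rabs_pos_eq; lra. }
    assert (Hn0 : forall y, (z + t * unit_circle y - z)%C <> 0%C).
    { intros y. apply Cmod_gt_0. rewrite Hd0. lra. }
    eapply is_CInt_bound; [lra| |apply circle_integral_correct].
    + intros y Hy. cbv beta. rewrite Cmod_mult. unfold G. rewrite Cmod_div by apply Hn0.
      rewrite Hd0. rewrite Cmod_mult, Cmod_unit_circle, Cmod_R, (Rabs_pos_eq t) by lra.
      replace (Cmod (f (z + t * unit_circle y) - f z) / t * (t * 1))
        with (Cmod (f (z + t * unit_circle y) - f z)) by (field; lra).
      assert (Hw := Hd0 y). assert (H1 := Hld (z + t * unit_circle y)%C).
      set (w := (z + t * unit_circle y)%C) in *. rewrite Hw in H1. specialize (H1 ltac:(lra)).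
      replace (f w - f z)%C with ((f w - f z - l * (w - z)) + l * (w - z))%C by ring.
      eapply Rle_trans; [apply Cmod_triangle|]. rewrite Cmod_mult, Hw. nra.
    + intros y Hy. apply HG.
      * eapply Rle_lt_trans; [apply Cmod_triangle|].
        rewrite Cmod_mult, Cmod_unit_circle, Cmod_R, (Rabs_pos_eq t) by lra. lra.
      * intros E. apply (Hn0 y). rewrite E. ring.
  - intros x y Hx Hy.
    assert (Hrad : 0 <= r + x * (t - r)) by nra.
    apply HG.
    + eapply Rle_lt_trans; [apply Cmod_triangle|].
      rewrite Cmod_mult, Cmod_unit_circle, Cmod_R, (Rabs_pos_eq (r + _)) by lra.
      replace (0 + x * (z - 0))%C with (x * z)%C by ring.
      rewrite Cmod_mult, Cmod_R, (Rabs_pos_eq x) by lra. nra.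
    + intros E.
      assert (E2 : ((r + x * (t - r))%R * unit_circle y)%C = ((1 - x)%R * z)%C).
      { set (u := ((r + x * (t - r))%R * unit_circle y)%C) in *.
        replace u with ((0 + x * (z - 0) + u) - x * z)%C by ring.
        rewrite E, RtoC_minus. ring. }
      apply (f_equal Cmod) in E2.
      rewrite !Cmod_mult, Cmod_unit_circle, !Cmod_R, !Rabs_pos_eq in E2 by lra.
      nra. }
destruct (Ceq_dec (circle_integral G 0 r) 0) as [E|N]; [exact E|exfalso].
apply Cmod_gt_0 in N. set (m := Cmod (circle_integral G 0 r)) in *.
assert (HL : 0 < Cmod l + 1) by (pose proof (Cmod_ge_0 l); lra).
set (t := Rmin e (m / (2 * (Cmod l + 1)))).
assert (Ht : 0 < t) by (apply Rmin_case; [lra|]; apply Rdiv_lt_0_compat; lra).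
assert (Ht2 : t <= m / (2 * (Cmod l + 1))) by apply Rmin_r.
assert (H1 := Hsmall t (conj Ht (Rmin_l _ _))).
assert (H2 : t * (Cmod l + 1) <= m / 2).
{ replace (m / 2) with (m / (2 * (Cmod l + 1)) * (Cmod l + 1)) by (field; lra).
  apply Rmult_le_compat_r; lra. }
lra.
Qed.
End CauchyFormula.

(** * Complex series and power series *)

Definition is_csum (u : nat -> C) (l : C) : Prop :=
  is_series (K := C_AbsRing) (V := C_NormedModule) u l.

Lemma is_csum_eps u l : is_csum u l <->
  forall eps, 0 < eps -> exists N, forall n, (N <= n)%nat ->
    Cmod (sum_n (G := C_AbelianMonoid) u n - l) < eps.
Proof.
split.
- intros H eps He.
  assert (L := proj1 (filterlim_locally_ball_norm (K := C_AbsRing) (U := C_NormedModule)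
    (F := eventually) (sum_n (G := C_AbelianMonoid) u) l) H (mkposreal eps He)).
  destruct L as [N HN]. exists N. intros n Hn. exact (HN n Hn).
- intros H.
  apply (filterlim_locally_ball_norm (K := C_AbsRing) (U := C_NormedModule)).
  intros [eps He]. destruct (H eps He) as [N HN]. exists N. intros n Hn. exact (HN n Hn).
Qed.

Lemma is_csum_ext u v l : (forall n, u n = v n) -> is_csum u l -> is_csum v l.
Proof. apply is_series_ext. Qed.

Lemma is_csum_unique u l m : is_csum u l -> is_csum u m -> l = m.
Proof.
intros H1 H2. exact (filterlim_locally_unique (K := C_AbsRing) (V := C_NormedModule) _ l m H1 H2).
Qed.

Lemma is_csum_plus u v l m : is_csum u l -> is_csum v m -> is_csum (fun n => u n + v n)%C (l + m).
Proof. apply (is_series_plus (K := C_AbsRing) (V := C_NormedModule)). Qed.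

Lemma is_csum_minus u v l m : is_csum u l -> is_csum v m -> is_csum (fun n => u n - v n)%C (l - m).
Proof. apply (is_series_minus (K := C_AbsRing) (V := C_NormedModule)). Qed.

Lemma is_csum_scal c u l : is_csum u l -> is_csum (fun n => c * u n)%C (c * l).
Proof. apply (is_series_scal (K := C_AbsRing) (V := C_NormedModule)). Qed.

Lemma is_csum_tail u l : is_csum u l -> is_csum (fun n => u (S n)) (l - u 0%nat).
Proof.
intros H. apply (is_series_incr_1 (K := C_AbsRing) (V := C_NormedModule)).
unfold plus; simpl. replace (l - u 0%nat + u 0%nat)%C with l by ring. exact H.
Qed.

Lemma is_csum_cons u l : is_csum (fun n => u (S n)) l -> is_csum u (l + u 0%nat).
Proof.
intros H. apply (is_series_decr_1 (K := C_AbsRing) (V := C_NormedModule)).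
unfold plus, opp; simpl. replace (l + u 0%nat + - u 0%nat)%C with l by ring. exact H.
Qed.

Lemma is_csum_bound u l (v : nat -> R) L :
  is_csum u l -> (forall n, Cmod (u n) <= v n) -> is_series v L -> Cmod l <= L.
Proof.
intros Hu Huv Hv.
apply le_epsilon. intros eps He.
destruct (proj1 (is_csum_eps u l) Hu (eps / 2)) as [N1 H1]; [lra|].
assert (He2 : 0 < eps / 2) by lra.
destruct (proj1 (filterlim_locally (sum_n v) L) Hv (mkposreal _ He2)) as [N2 H2].
set (n := Nat.max N1 N2).
specialize (H1 n ltac:(lia)). specialize (H2 n ltac:(lia)).
change (Rabs (sum_n v n - L) < eps / 2) in H2. apply Rabs_def2 in H2.
assert (H3 : Cmod (sum_n (G := C_AbelianMonoid) u n) <= sum_n v n).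
{ clear H1 H2. induction n as [|k IH].
  - rewrite !sum_O. apply Huv.
  - rewrite !sum_Sn. eapply Rle_trans; [apply Cmod_triangle|].
    apply Rplus_le_compat; [exact IH|apply Huv]. }
set (p := sum_n (G := C_AbelianMonoid) u n) in *.
replace l with (p - (p - l))%C by ring.
eapply Rle_trans; [apply Cmod_triangle_minus|]. lra.
Qed.

Lemma ex_csum_abs u (v : nat -> R) :
  (forall n, Cmod (u n) <= v n) -> ex_series v -> exists l, is_csum u l.
Proof.
intros H Hv. apply (ex_series_le (K := C_AbsRing) (V := C_CompleteNormedModule) u v H Hv).
Qed.

Lemma is_csum_terms_bounded u l : is_csum u l -> exists M, forall n, Cmod (u n) <= M.
Proof.
intros H. destruct (proj1 (is_csum_eps u l) H 1) as [N HN]; [lra|].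
assert (Hfin : forall m, exists M, forall n, (n <= m)%nat -> Cmod (u n) <= M).
{ induction m as [|m [M HM]].
  - exists (Cmod (u 0%nat)). intros n Hn. replace n with 0%nat by lia. lra.
  - exists (Rmax M (Cmod (u (S m)))). intros n Hn.
    destruct (Nat.eq_dec n (S m)) as [->|Hne]; [apply Rmax_r|].
    eapply Rle_trans; [apply HM; lia|apply Rmax_l]. }
destruct (Hfin N) as [M HM]. exists (Rmax M 2). intros n.
destruct (Nat.le_gt_cases n N) as [Hle|Hgt].
- eapply Rle_trans; [now apply HM|apply Rmax_l].
- eapply Rle_trans; [|apply Rmax_r]. destruct n as [|n]; [lia|].
  assert (H1 := HN n ltac:(lia)). assert (H2 := HN (S n) ltac:(lia)).
  rewrite sum_Sn in H2.
  set (p := sum_n (G := C_AbelianMonoid) u n) in *.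
  change (Cmod (p + u (S n) - l) < 1) in H2.
  replace (u (S n)) with ((p + u (S n) - l) - (p - l))%C by ring.
  eapply Rle_trans; [apply Cmod_triangle_minus|]. lra.
Qed.

(** All radii below [rho] rather than [rho] itself: convergence on the open disk, which termwise
    differentiation preserves. *)
Definition abs_conv (a : nat -> C) (rho : R) : Prop :=
  forall s, 0 <= s < rho -> ex_series (fun n => Cmod (a n) * s ^ n).

Definition is_ps (a : nat -> C) (z l : C) : Prop := is_csum (fun n => a n * z ^ n)%C l.

Lemma abs_conv_bounded a rho :
  (forall s, 0 < s < rho -> exists M, forall n, Cmod (a n) * s ^ n <= M) -> abs_conv a rho.
Proof.
intros H s Hs. destruct (H ((s + rho) / 2)) as [M HM]; [lra|].
set (t := (s + rho) / 2) in *.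
assert (Ht : 0 < t) by (unfold t; lra). assert (Hst : s < t) by (unfold t; lra).
assert (Hq : 0 <= s / t < 1).
{ split; [apply Rdiv_le_0_compat; lra|]. apply Rmult_lt_reg_r with t; [easy|].
  unfold Rdiv. rewrite Rmult_assoc, Rinv_l; lra. }
apply (ex_series_le (K := R_AbsRing) (V := R_CompleteNormedModule)) with (fun n => M * (s / t) ^ n).
- intros n. change (Rabs (Cmod (a n) * s ^ n) <= M * (s / t) ^ n).
  rewrite Rabs_pos_eq by (apply Rmult_le_pos; [apply Cmod_ge_0|apply pow_le; lra]).
  replace (s ^ n) with (t ^ n * (s / t) ^ n).
  2:{ rewrite <- Rpow_mult_distr. f_equal. field. lra. }
  rewrite <- Rmult_assoc. apply Rmult_le_compat_r; [apply pow_le; lra|apply HM].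
- apply (ex_series_scal_l (K := R_AbsRing) (V := R_NormedModule) M). apply ex_series_geom.
  rewrite Rabs_pos_eq; lra.
Qed.

Lemma ps_abs_conv a rho : (forall z, 0 < Cmod z < rho -> exists l, is_ps a z l) -> abs_conv a rho.
Proof.
intros H. apply abs_conv_bounded. intros s Hs.
assert (Hc : Cmod s = s) by (rewrite Cmod_R, Rabs_pos_eq; lra).
destruct (H (RtoC s)) as [l Hl]; [lra|].
destruct (is_csum_terms_bounded _ _ Hl) as [M HM]. exists M. intros n.
specialize (HM n). rewrite Cmod_mult, Cmod_pow, Hc in HM. exact HM.
Qed.

Lemma abs_conv_ps a rho z : abs_conv a rho -> Cmod z < rho -> exists l, is_ps a z l.
Proof.
intros H Hz. apply ex_csum_abs with (fun n => Cmod (a n) * Cmod z ^ n).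
- intros n. rewrite Cmod_mult, Cmod_pow. lra.
- apply H. split; [apply Cmod_ge_0|exact Hz].
Qed.

Definition deriv_coef (a : nat -> C) (n : nat) : C := (INR (S n) * a (S n))%C.

(** Access to the real theory, in particular to the fact that differentiating a power series
    keeps its radius of convergence. *)
Lemma abs_conv_CV_radius a rho : 0 < rho ->
  abs_conv a rho <-> Rbar_le rho (CV_radius (fun n => Cmod (a n))).
Proof.
intros Hrho. split.
- intros H. apply Rbar_not_lt_le. intros Hlt.
  assert (Hlub := proj1 (Lub_Rbar_correct (CV_disk (fun n => Cmod (a n))))).
  fold (CV_radius (fun n => Cmod (a n))) in Hlub.
  assert (H0 : Rbar_le 0 (CV_radius (fun n => Cmod (a n)))) by apply CV_radius_ge_0.
  destruct (CV_radius (fun n => Cmod (a n))) as [c| |]; simpl in *; try easy.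
  assert (Hc : Rbar_le ((c + rho) / 2) c).
  { apply Hlub. unfold CV_disk.
    apply ex_series_ext with (fun n => Cmod (a n) * ((c + rho) / 2) ^ n).
    - intros n. symmetry. apply Rabs_pos_eq.
      apply Rmult_le_pos; [apply Cmod_ge_0|apply pow_le; lra].
    - apply H. lra. }
  simpl in Hc. lra.
- intros H s Hs.
  apply ex_series_ext with (fun n => Rabs (Cmod (a n) * s ^ n)).
  + intros n. apply Rabs_pos_eq.
    apply Rmult_le_pos; [apply Cmod_ge_0|apply pow_le; lra].
  + apply CV_disk_inside. apply Rbar_lt_le_trans with rho; [|exact H].
    simpl. rewrite Rabs_pos_eq; lra.
Qed.

Lemma abs_conv_deriv_coef a rho : 0 < rho -> abs_conv a rho -> abs_conv (deriv_coef a) rho.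
Proof.
intros Hr H. apply abs_conv_CV_radius; [exact Hr|]. apply abs_conv_CV_radius in H; [|exact Hr].
rewrite <- CV_radius_derive in H.
rewrite (CV_radius_ext _ (fun n => Cmod (deriv_coef a n))) in H; [exact H|].
intros n. unfold PS_derive, deriv_coef. rewrite Cmod_mult, Cmod_R, Rabs_pos_eq; [reflexivity|].
apply pos_INR.
Qed.

(** The remainder [D_n] of the first-order expansion of [w^n] at [z] satisfies
    [D_(n+1) = w D_n + n z^(n-1) (w - z)^2]. *)
Lemma pow_increment_bound (z w : C) s n :
  Cmod z <= s -> Cmod w <= s ->
  Cmod (w ^ S (S n) - z ^ S (S n) - INR (S (S n)) * z ^ S n * (w - z))
    <= INR (S (S n)) * INR (S n) * s ^ n * Cmod (w - z) ^ 2.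
Proof.
intros Hz Hw. assert (Hs : 0 <= s) by (eapply Rle_trans; [apply Cmod_ge_0|exact Hz]).
induction n as [|n IH].
- replace (w ^ 2 - z ^ 2 - INR 2 * z ^ 1 * (w - z))%C with ((w - z) ^ 2)%C.
  + rewrite Cmod_pow. simpl. pose proof (Cmod_ge_0 (w - z)). nra.
  + change (INR 2) with (1 + 1). rewrite RtoC_plus. ring.
- set (D := (w ^ S (S n) - z ^ S (S n) - INR (S (S n)) * z ^ S n * (w - z))%C) in *.
  replace (w ^ S (S (S n)) - z ^ S (S (S n)) - INR (S (S (S n))) * z ^ S (S n) * (w - z))%C
    with (w * D + INR (S (S n)) * z ^ S n * (w - z) ^ 2)%C.
  2:{ unfold D. rewrite (S_INR (S (S n))), RtoC_plus. simpl Cpow. ring. }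
  eapply Rle_trans; [apply Cmod_triangle|].
  rewrite !Cmod_mult, !Cmod_pow, Cmod_R, (Rabs_pos_eq (INR _)) by apply pos_INR.
  set (d := Cmod (w - z)) in *. assert (Hd : 0 <= d) by apply Cmod_ge_0.
  assert (A1 : Cmod w * Cmod D <= s * (INR (S (S n)) * INR (S n) * s ^ n * d ^ 2)).
  { apply Rmult_le_compat; try apply Cmod_ge_0; assumption. }
  assert (A2 : INR (S (S n)) * Cmod z ^ S n * d ^ 2 <= INR (S (S n)) * s ^ S n * d ^ 2).
  { apply Rmult_le_compat_r; [nra|]. apply Rmult_le_compat_l; [apply pos_INR|].
    apply pow_incr. split; [apply Cmod_ge_0|exact Hz]. }
  assert (P : 0 <= s ^ S n * d ^ 2 * INR (S (S n))).
  { apply Rmult_le_pos; [apply Rmult_le_pos; apply pow_le; assumption|apply pos_INR]. }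
  rewrite (S_INR (S (S n))).
  replace (s * (INR (S (S n)) * INR (S n) * s ^ n * d ^ 2))
    with (s ^ S n * d ^ 2 * INR (S (S n)) * INR (S n)) in A1 by (simpl; ring).
  rewrite (S_INR (S n)) in *. nra.
Qed.

(** By [pow_increment_bound] the first-order remainder of the sum is at most [(w - z)^2] times the
    second termwise derivative of the series of absolute values. *)
Lemma ps_cderiv a rho F z l :
  abs_conv a rho -> (forall w, Cmod w < rho -> is_ps a w (F w)) ->
  Cmod z < rho -> is_ps (deriv_coef a) z l -> is_cderiv F z l.
Proof.
intros Ha HF Hz Hl.
assert (Hrho : 0 < rho) by (eapply Rle_lt_trans; [apply Cmod_ge_0|exact Hz]).
set (s := (Cmod z + rho) / 2). pose proof (Cmod_ge_0 z).
assert (Hs : Cmod z < s < rho) by (unfold s; lra).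
(* The terms of index 0 and 1 have no first-order remainder. *)
set (v := fun n => match n with
  | S (S m) => Cmod (a n) * (INR n * INR (S m) * s ^ m)
  | _ => 0 end).
assert (Hv : ex_series v).
{ apply ex_series_incr_1, ex_series_incr_1.
  apply ex_series_ext with (fun n => Cmod (deriv_coef (deriv_coef a) n) * s ^ n).
  - intros n. unfold v, deriv_coef. rewrite !Cmod_mult, !Cmod_R, !Rabs_pos_eq by apply pos_INR.
    match goal with |- ?x = ?y => change (@eq R x y) end. ring.
  - apply abs_conv_deriv_coef with rho; [easy| |lra]. now apply abs_conv_deriv_coef. }
destruct Hv as [V HV].
apply cderiv_quadratic with V (s - Cmod z); [lra|].
intros w Hw.
assert (Hws : Cmod w <= s).
{ replace w with (z + (w - z))%C by ring. eapply Rle_trans; [apply Cmod_triangle|]. lra. }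
apply (is_csum_bound
  (fun n => a n * w ^ n - a n * z ^ n - (w - z) * (INR n * a n * z ^ pred n))%C
  (F w - F z - l * (w - z)) (fun n => V * 0 + v n * Cmod (w - z) ^ 2)).
- replace (l * (w - z))%C with ((w - z) * l)%C by ring.
  apply is_csum_minus; [apply is_csum_minus; apply HF; lra|].
  apply is_csum_scal.
  replace l with (l + INR 0 * a 0%nat * z ^ pred 0)%C.
  + apply (is_csum_cons (fun n => INR n * a n * z ^ pred n)%C). exact Hl.
  + change (INR 0) with 0. ring.
- intros n.
  replace (a n * w ^ n - a n * z ^ n - (w - z) * (INR n * a n * z ^ pred n))%C
    with (a n * (w ^ n - z ^ n - INR n * z ^ pred n * (w - z)))%C by ring.
  rewrite Cmod_mult. destruct n as [|[|n]].
  + change (INR 0) with 0. simpl pred. simpl Cpow.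
    replace (1 - 1 - 0 * 1 * (w - z))%C with (RtoC 0) by ring. rewrite Cmod_0. simpl. lra.
  + change (INR 1) with 1. simpl pred. simpl Cpow.
    replace (w * 1 - z * 1 - 1 * 1 * (w - z))%C with (RtoC 0) by ring. rewrite Cmod_0. simpl. lra.
  + simpl pred. unfold v. rewrite Rmult_0_r, Rplus_0_l, Rmult_assoc.
    apply Rmult_le_compat_l; [apply Cmod_ge_0|]. apply pow_increment_bound; lra.
- apply is_series_ext with (fun n => Cmod (w - z) ^ 2 * v n); 
    [intros; match goal with |- ?x = ?y => change (@eq R x y) end; ring|].
  rewrite Rmult_comm.
  apply (is_series_scal (K := R_AbsRing) (V := R_NormedModule)). exact HV.
Qed.

(** The expansion of [F] at 0 modulo [O(z^3)].  The point 0 itself is excluded, so that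
    [f z / z] has such an expansion. *)
Definition jet2 (F : C -> C) (a0 a1 a2 : C) : Prop :=
  exists K d, 0 < d /\ forall z, 0 < Cmod z < d ->
    Cmod (F z - (a0 + a1 * z + a2 * z ^ 2)) <= K * Cmod z ^ 3.

Lemma ps_jet2 a rho F :
  0 < rho -> (forall w, 0 < Cmod w < rho -> is_ps a w (F w)) ->
  jet2 F (a 0%nat) (a 1%nat) (a 2%nat).
Proof.
intros Hrho HF.
assert (Ha : abs_conv a rho) by (apply ps_abs_conv; intros z Hz; exists (F z); now apply HF).
set (s := rho / 2). assert (Hs : 0 < s < rho) by (unfold s; lra).
assert (Hv : ex_series (fun n => Cmod (a (S (S (S n)))) * s ^ S (S (S n)))).
{ apply (ex_series_incr_1 (fun n => Cmod (a (S (S n))) * s ^ S (S n))).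
  apply (ex_series_incr_1 (fun n => Cmod (a (S n)) * s ^ S n)).
  apply (ex_series_incr_1 (fun n => Cmod (a n) * s ^ n)). apply Ha. lra. }
destruct Hv as [V HV].
exists (V / s ^ 3), s. split; [lra|]. intros z Hz.
apply (is_csum_bound (fun n => a (S (S (S n))) * z ^ S (S (S n)))%C _
  (fun n => (Cmod z / s) ^ 3 * (Cmod (a (S (S (S n)))) * s ^ S (S (S n))))).
- assert (H := HF z ltac:(lra)). unfold is_ps in H.
  apply is_csum_tail in H. apply is_csum_tail in H. apply is_csum_tail in H.
  match type of H with is_csum _ ?l => replace l with
    (F z - (a 0%nat + a 1%nat * z + a 2%nat * z ^ 2))%C in H by (simpl; ring) end.
  exact H.
- intros n. rewrite Cmod_mult, Cmod_pow.
  replace ((Cmod z / s) ^ 3 * (Cmod (a (S (S (S n)))) * s ^ S (S (S n))))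
    with (Cmod (a (S (S (S n)))) * (Cmod z ^ 3 * s ^ n)) by (simpl; field; lra).
  apply Rmult_le_compat_l; [apply Cmod_ge_0|].
  replace (Cmod z ^ S (S (S n))) with (Cmod z ^ 3 * Cmod z ^ n) by (simpl; ring).
  apply Rmult_le_compat_l; [apply pow_le, Cmod_ge_0|]. apply pow_incr.
  split; [apply Cmod_ge_0|lra].
- replace (V / s ^ 3 * Cmod z ^ 3) with ((Cmod z / s) ^ 3 * V) by (field; lra).
  apply (is_series_scal (K := R_AbsRing) (V := R_NormedModule)). exact HV.
Qed.

(** Letting [z] tend to 0 kills the coefficients one after the other. *)
Lemma cubic_unique (a0 a1 a2 : C) K d :
  0 < d -> (forall z, 0 < Cmod z < d -> Cmod (a0 + a1 * z + a2 * z ^ 2) <= K * Cmod z ^ 3) ->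
  a0 = 0%C /\ a1 = 0%C /\ a2 = 0%C.
Proof.
intros Hd H.
assert (Small : forall b M, (forall t, 0 < t < d -> Cmod b <= M * t) -> b = 0%C).
{ intros b M Hb. apply Cmod_eq_0. apply Rle_antisym; [|apply Cmod_ge_0].
  apply le_epsilon. intros eps He. rewrite Rplus_0_l.
  pose proof (Rabs_pos M). pose proof (Rle_abs M).
  set (t := Rmin (d / 2) (eps / (Rabs M + 1))).
  assert (Ht : 0 < t) by (apply Rmin_case; [lra|apply Rdiv_lt_0_compat; lra]).
  assert (Ht1 : t <= d / 2) by apply Rmin_l.
  assert (Ht2 : t <= eps / (Rabs M + 1)) by apply Rmin_r.
  assert (Ht3 : t * (Rabs M + 1) <= eps).
  { replace eps with (eps / (Rabs M + 1) * (Rabs M + 1)) by (field; lra).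
    apply Rmult_le_compat_r; lra. }
  specialize (Hb t ltac:(lra)). nra. }
assert (Hr : forall t, 0 < t < d -> Cmod (a0 + a1 * t + a2 * t ^ 2) <= K * t ^ 3).
{ intros t Ht. assert (E : Cmod t = t) by (rewrite Cmod_R, Rabs_pos_eq; lra).
  replace (K * t ^ 3) with (K * Cmod t ^ 3) by now rewrite E.
  apply H. lra. }
clear H. rename Hr into H.
assert (HK : 0 <= K).
{ specialize (H (d / 2) ltac:(lra)).
  pose proof (Cmod_ge_0 (a0 + a1 * (d / 2)%R + a2 * (d / 2)%R ^ 2)).
  assert (0 < (d / 2) ^ 3) by (apply pow_lt; lra). nra. }
assert (E0 : a0 = 0%C).
{ apply (Small a0 (K * d ^ 2 + Cmod a1 + Cmod a2 * d)). intros t Ht.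
  replace a0 with ((a0 + a1 * t + a2 * t ^ 2) - (a1 * t + a2 * t ^ 2))%C by ring.
  eapply Rle_trans; [apply Cmod_triangle_minus|]. specialize (H t Ht).
  assert (H2 := Cmod_triangle (a1 * t) (a2 * t ^ 2)).
  rewrite !Cmod_mult, Cmod_pow, !Cmod_R, !(Rabs_pos_eq t) in H2 by lra.
  assert (K * t ^ 3 <= K * d ^ 2 * t).
  { replace (K * t ^ 3) with (K * t ^ 2 * t) by ring. apply Rmult_le_compat_r; [lra|].
    apply Rmult_le_compat_l; [easy|]. apply pow_incr; lra. }
  pose proof (Cmod_ge_0 a2).
  assert (0 <= Cmod a2 * (t * (d - t))).
  { apply Rmult_le_pos; [easy|]. apply Rmult_le_pos; lra. }
  simpl in *. lra. }
subst a0.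
assert (E1 : a1 = 0%C).
{ apply (Small a1 (K * d + Cmod a2)). intros t Ht.
  specialize (H t Ht).
  replace (0 + a1 * t + a2 * t ^ 2)%C with (t * (a1 + a2 * t))%C in H by (simpl; ring).
  rewrite Cmod_mult, Cmod_R, Rabs_pos_eq in H by lra.
  assert (H3 : Cmod (a1 + a2 * t) <= K * t ^ 2).
  { apply Rmult_le_reg_l with t; [lra|]. replace (t * (K * t ^ 2)) with (K * t ^ 3) by ring. easy. }
  replace a1 with ((a1 + a2 * t) - a2 * t)%C by ring.
  eapply Rle_trans; [apply Cmod_triangle_minus|].
  rewrite Cmod_mult, Cmod_R, Rabs_pos_eq by lra.
  assert (0 <= K * (t * (d - t))).
  { apply Rmult_le_pos; [easy|]. apply Rmult_le_pos; lra. }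
  simpl in *. lra. }
subst a1. repeat split.
apply (Small a2 K). intros t Ht. specialize (H t Ht).
replace (0 + 0 * t + a2 * t ^ 2)%C with (t ^ 2 * a2)%C in H by (simpl; ring).
rewrite Cmod_mult, Cmod_pow, Cmod_R, Rabs_pos_eq in H by lra.
apply Rmult_le_reg_l with (t ^ 2); [apply pow_lt; lra|].
replace (t ^ 2 * (K * t)) with (K * t ^ 3) by ring. easy.
Qed.

(** * Taylor series on a disk *)

Definition taylor_coef (f : C -> C) (r : R) (k : nat) : C :=
  CInt (fun y => f (r * unit_circle y) * (/ (r * unit_circle y)) ^ k)%C 0 1.

Lemma r_unit_circle_neq_0 (r : R) y : 0 < r -> (r * unit_circle y)%C <> 0%C.
Proof.
intros Hr. apply Cmult_neq_0; [|apply unit_circle_neq_0].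
intros E. apply RtoC_inj in E. lra.
Qed.

Lemma Cmod_r_unit_circle (r : R) y : 0 <= r -> Cmod (r * unit_circle y) = r.
Proof. intros Hr. rewrite Cmod_mult, Cmod_unit_circle, Cmod_R, Rabs_pos_eq; lra. Qed.

Lemma path_cont_r_unit_circle (r : R) y : path_cont (fun t => r * unit_circle t)%C y.
Proof. apply path_cont_mult; [apply path_cont_const|apply path_cont_unit_circle]. Qed.

Lemma path_cont_inv_r_unit_circle (r : R) y : 0 < r -> path_cont (fun t => / (r * unit_circle t))%C y.
Proof.
intros Hr. eapply (path_cont_comp Cinv); [|apply path_cont_r_unit_circle].
apply cderiv_inv. now apply r_unit_circle_neq_0.
Qed.

(** For a positive exponent the integrand is, up to a constant factor, the derivative of a
    function of period 1. *)
Lemma is_CInt_inv_pow (r : R) k : 0 < r ->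
  is_CInt (fun y => (/ (r * unit_circle y)) ^ S k)%C 0 1 0.
Proof.
intros Hr.
set (m := (- (INR (S k) * two_pi_i))%C).
assert (Hm : m <> 0%C).
{ intros E. assert (E2 : (INR (S k) * two_pi_i)%C = 0%C).
  { replace (INR (S k) * two_pi_i)%C with (- m)%C by (unfold m; ring). rewrite E. ring. }
  apply (Cmult_neq_0 (INR (S k)) two_pi_i); [| apply two_pi_i_neq_0|exact E2].
  intros H. apply RtoC_inj in H. pose proof (lt_0_INR (S k) ltac:(lia)). lra. }
set (g := fun y => (/ (r * unit_circle y))%C).
assert (H : is_CInt (fun y => m * g y ^ S k)%C 0 1 (g 1 ^ S k - g 0 ^ S k)).
{ apply (is_CInt_FTC (fun y => g y ^ S k)%C).
  - intros t _.
    replace (m * g t ^ S k)%C with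
      (INR (S k) * g t ^ k * (- / ((r * unit_circle t) * (r * unit_circle t)) *
        (r * (two_pi_i * unit_circle t))))%C.
    + apply (path_deriv_comp (fun w => w ^ S k)%C g); [apply (cderiv_pow (S k))|].
      apply (path_deriv_comp Cinv (fun y => r * unit_circle y)%C).
      * apply cderiv_inv. now apply r_unit_circle_neq_0.
      * apply (path_deriv_comp (fun w => r * w)%C unit_circle); [|apply path_deriv_unit_circle].
        apply cderiv_ext with (fun w => 0 + r * w)%C; [intros; ring|]. apply cderiv_affine.
    + unfold m, g. simpl Cpow. field. split.
      * apply unit_circle_neq_0.
      * intros E. apply RtoC_inj in E. lra.
  - intros t _. apply path_cont_mult; [apply path_cont_const|]. apply path_cont_pow.
    now apply path_cont_inv_r_unit_circle. }
assert (E : (g 1 ^ S k - g 0 ^ S k)%C = 0%C) by (unfold g; rewrite unit_circle_1; ring).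
rewrite E in H.
apply (is_CInt_scal (/ m)) in H. rewrite Cmult_0_r in H.
revert H. apply is_CInt_ext. intros t _. unfold g. simpl Cpow. field.
split; [apply unit_circle_neq_0|]. split; [|exact Hm].
intros E'. apply RtoC_inj in E'. lra.
Qed.

Section Taylor.

Variables (f : C -> C) (rho : R).
Hypothesis Hf : forall z, Cmod z < rho -> exists l, is_cderiv f z l.

Lemma path_cont_on_circle (r : R) y : 0 < r < rho -> path_cont (fun t => f (r * unit_circle t)) y.
Proof.
intros Hr. destruct (Hf (r * unit_circle y)%C) as [l Hl].
{ rewrite Cmod_r_unit_circle; lra. }
apply (path_cont_comp f (fun t => r * unit_circle t)%C y l Hl). apply path_cont_r_unit_circle.
Qed.

Lemma taylor_coef_correct (r : R) k : 0 < r < rho ->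
  is_CInt (fun y => f (r * unit_circle y) * (/ (r * unit_circle y)) ^ k)%C 0 1 (taylor_coef f r k).
Proof.
intros Hr. apply CInt_correct. intros t _. apply path_cont_mult.
- now apply path_cont_on_circle.
- apply path_cont_pow. apply path_cont_inv_r_unit_circle. lra.
Qed.

(** Apply [circle_homotopy] to [f w / w^(k+1)] on concentric circles. *)
Lemma taylor_coef_indep (r0 r1 : R) k :
  0 < r0 < rho -> 0 < r1 < rho -> taylor_coef f r0 k = taylor_coef f r1 k.
Proof.
intros H0 H1.
set (G := fun w => (f w * (/ w) ^ S k)%C).
assert (HG : forall w : C, 0 < Cmod w < rho -> exists l, is_cderiv G w l).
{ intros w Hw. destruct (Hf w) as [l Hl]; [lra|]. eexists.
  apply cderiv_mult; [exact Hl|].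
  apply (cderiv_comp (fun w => w ^ S k)%C Cinv); [apply cderiv_pow|].
  apply cderiv_inv. apply Cmod_gt_0. lra. }
assert (E : forall r : R, 0 < r < rho -> circle_integral G 0 r = taylor_coef f r k).
{ intros r Hr. symmetry. apply is_CInt_unique.
  apply is_CInt_ext with (fun y => G (0 + r * unit_circle y) * (r * unit_circle y))%C.
  - intros t _. unfold G. rewrite Cplus_0_l. simpl Cpow. field. split.
    + apply unit_circle_neq_0.
    + intros E'. apply RtoC_inj in E'. lra.
  - apply circle_integral_correct. intros y _. apply HG.
    rewrite Cplus_0_l, Cmod_r_unit_circle; lra. }
rewrite <- !E by easy. apply circle_homotopy. intros x y Hx _. apply HG.
replace (0 + x * (0 - 0))%C with (RtoC 0) by ring. rewrite Cplus_0_l.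
assert (0 < r0 + x * (r1 - r0) < rho) by (destruct (Rle_dec r0 r1); split; nra).
rewrite Cmod_r_unit_circle; lra.
Qed.

(** Start from [cauchy_quotient] and use [w / (w - z) = 1 + (z / w) (w / (w - z))] repeatedly.
    Each step splits off one Taylor term; the constant [f z] only meets the exponent 0, since the
    integrals of [w^(-k)] vanish for positive [k]. *)
Lemma taylor_remainder (z : C) (r : R) n :
  Cmod z < r -> r < rho ->
  is_CInt (fun y => (z * / (r * unit_circle y)) ^ S n *
     ((f (r * unit_circle y) - f z) * (r * unit_circle y) / (r * unit_circle y - z)))%C 0 1
   (f z - sum_n (G := C_AbelianMonoid) (fun k => taylor_coef f r k * z ^ k)%C n).
Proof.
intros Hz Hr. pose proof (Cmod_ge_0 z) as Hz0.
assert (Hn0 : forall y, (r * unit_circle y)%C <> 0%C) by (intros; apply r_unit_circle_neq_0; lra).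
assert (Hnz : forall y, (r * unit_circle y - z)%C <> 0%C).
{ intros y. apply Cminus_eq_contra. intros E. apply (f_equal Cmod) in E.
  rewrite Cmod_r_unit_circle in E; lra. }
set (Q := fun y => ((f (r * unit_circle y) - f z) * (r * unit_circle y) / (r * unit_circle y - z))%C).
assert (H0 : is_CInt Q 0 1 0).
{ rewrite <- (cauchy_quotient f rho Hf z r) by lra.
  apply is_CInt_ext with (fun y => ((f (0 + r * unit_circle y) - f z) / (0 + r * unit_circle y - z))
    * (r * unit_circle y))%C.
  - intros t _. unfold Q. rewrite Cplus_0_l. field. apply Hnz.
  - apply (circle_integral_correct (fun w => (f w - f z) / (w - z))%C).
    intros y _. rewrite Cplus_0_l. destruct (Hf (r * unit_circle y)%C) as [l Hl].
    { rewrite Cmod_r_unit_circle; lra. }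
    eexists. apply (cderiv_div (fun w => f w - f z)%C (fun w => w - z)%C).
    + apply Hnz.
    + apply cderiv_minus; [exact Hl|apply cderiv_const].
    + apply cderiv_minus; [apply cderiv_id|apply cderiv_const]. }
assert (Step : forall m I J, is_CInt (fun y => (z * / (r * unit_circle y)) ^ m * Q y)%C 0 1 I ->
  is_CInt (fun y => (/ (r * unit_circle y)) ^ m)%C 0 1 J ->
  is_CInt (fun y => (z * / (r * unit_circle y)) ^ S m * Q y)%C 0 1
    (I - z ^ m * (taylor_coef f r m - f z * J))).
{ intros m I J HI HJ.
  apply is_CInt_ext with (fun y => (z * / (r * unit_circle y)) ^ m * Q y -
     z ^ m * (f (r * unit_circle y) * (/ (r * unit_circle y)) ^ m -
       f z * (/ (r * unit_circle y)) ^ m))%C.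
  - intros t _. unfold Q. rewrite Cpow_S, Cpow_mult_l. set (p := ((/ (r * unit_circle t)) ^ m)%C).
    set (q := (z ^ m)%C). field. repeat split; try apply Hnz; try apply unit_circle_neq_0.
    intros E. apply RtoC_inj in E. lra.
  - apply is_CInt_minus; [exact HI|]. apply is_CInt_scal. apply is_CInt_minus.
    + apply taylor_coef_correct. lra.
    + now apply is_CInt_scal. }
induction n as [|n IH].
- rewrite sum_O.
  replace (f z - taylor_coef f r 0 * z ^ 0)%C
    with (0 - z ^ 0 * (taylor_coef f r 0 - f z * (RtoC (1 - 0) * 1)))%C.
  + apply Step.
    * apply is_CInt_ext with Q; [|exact H0]. intros t _. simpl. ring.
    * apply (is_CInt_const 1 0 1).
  + rewrite Rminus_0_r. simpl. ring.
- rewrite sum_Sn. set (s := sum_n (G := C_AbelianMonoid) (fun k => taylor_coef f r k * z ^ k)%C n) in *.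
  change (plus s (taylor_coef f r (S n) * z ^ S n)%C) with (s + taylor_coef f r (S n) * z ^ S n)%C.
  replace (f z - (s + taylor_coef f r (S n) * z ^ S n))%C
    with ((f z - s) - z ^ S n * (taylor_coef f r (S n) - f z * 0))%C by ring.
  apply Step; [exact IH|]. apply is_CInt_inv_pow. lra.
Qed.

Lemma taylor_on_circle (z : C) (r : R) :
  Cmod z < r -> r < rho -> is_ps (taylor_coef f r) z (f z).
Proof.
intros Hz Hr. pose proof (Cmod_ge_0 z) as Hz0.
assert (Hn0 : forall y, (r * unit_circle y)%C <> 0%C) by (intros; apply r_unit_circle_neq_0; lra).
assert (Hnz : forall y, (r * unit_circle y - z)%C <> 0%C).
{ intros y. apply Cminus_eq_contra. intros E. apply (f_equal Cmod) in E.
  rewrite Cmod_r_unit_circle in E; lra. }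
set (Q := fun y => ((f (r * unit_circle y) - f z) * (r * unit_circle y) / (r * unit_circle y - z))%C).
destruct (bounded_continuity (K := R_AbsRing) (V := C_R_NormedModule) Q 0 1) as [M HM].
{ intros t _. change (path_cont Q t). unfold Q, Cdiv. apply path_cont_mult; [apply path_cont_mult|].
  - apply path_cont_minus; [apply path_cont_on_circle; lra|apply path_cont_const].
  - apply path_cont_r_unit_circle.
  - apply (path_cont_comp Cinv (fun y => r * unit_circle y - z)%C t _ (cderiv_inv _ (Hnz t))).
    apply path_cont_minus; [apply path_cont_r_unit_circle|apply path_cont_const]. }
assert (HM' : forall y, 0 <= y <= 1 -> Cmod (Q y) <= M).
{ intros y Hy. rewrite <- norm_C_R. apply Rlt_le, HM, Hy. }
assert (HM0 : 0 <= M) by (eapply Rle_trans; [apply Cmod_ge_0|apply (HM' 0); lra]).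
assert (Hq : 0 <= Cmod z / r < 1).
{ split; [apply Rdiv_le_0_compat; lra|]. apply Rmult_lt_reg_r with r; [lra|].
  unfold Rdiv. rewrite Rmult_assoc, Rinv_l; lra. }
apply is_csum_eps. intros eps He.
destruct (pow_lt_1_zero (Cmod z / r)) with (y := eps / (M + 1)) as [N HN].
{ rewrite Rabs_pos_eq; lra. }
{ apply Rdiv_lt_0_compat; lra. }
exists N. intros n Hn.
specialize (HN (S n) ltac:(lia)). rewrite Rabs_pos_eq in HN by (apply pow_le; lra).
rewrite Cmod_minus_sym.
apply Rle_lt_trans with ((1 - 0) * ((Cmod z / r) ^ S n * M)).
- eapply is_CInt_bound; [lra| |apply taylor_remainder; [exact Hz|exact Hr]].
  intros y Hy. cbv beta. rewrite Cmod_mult, Cmod_pow, Cmod_mult, Cmod_inv by apply Hn0.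
  rewrite Cmod_r_unit_circle by lra. fold (Rdiv (Cmod z) r).
  apply Rmult_le_compat_l; [apply pow_le; lra|]. now apply HM'.
- assert (0 <= (Cmod z / r) ^ S n) by (apply pow_le; lra).
  replace eps with (eps / (M + 1) * (M + 1)) by (field; lra). nra.
Qed.

End Taylor.

(** The integral formula is part of the statement because it is what [toeplitz_form] uses. *)
Lemma taylor_disk f rho :
  0 < rho -> (forall z, Cmod z < rho -> exists l, is_cderiv f z l) ->
  exists a, (forall z, Cmod z < rho -> is_ps a z (f z)) /\
    forall (r : R) k, 0 < r < rho ->
      is_CInt (fun y => f (r * unit_circle y) * (/ (r * unit_circle y)) ^ k)%C 0 1 (a k).
Proof.
intros Hrho Hf. exists (taylor_coef f (rho / 2)). split.
- intros z Hz. pose proof (Cmod_ge_0 z). set (r := (Cmod z + rho) / 2).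
  apply is_csum_ext with (fun k => taylor_coef f r k * z ^ k)%C.
  + intros k. rewrite (taylor_coef_indep f rho Hf (rho / 2) r); [reflexivity|lra|unfold r; lra].
  + apply (taylor_on_circle f rho Hf); unfold r; lra.
- intros r k Hr. rewrite (taylor_coef_indep f rho Hf (rho / 2) r) by lra.
  now apply (taylor_coef_correct f rho Hf).
Qed.

(** * Expansions modulo cubic terms *)

Lemma jet2_near F a0 a1 a2 : jet2 F a0 a1 a2 ->
  exists K d, 0 <= K /\ 0 < d <= 1 /\ forall z, 0 < Cmod z < d ->
    Cmod (F z - (a0 + a1 * z + a2 * z ^ 2)) <= K * Cmod z ^ 3.
Proof.
intros [K [d [Hd H]]]. exists (Rabs K), (Rmin d 1).
pose proof (Rmin_l d 1). pose proof (Rmin_r d 1).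
split; [apply Rabs_pos|]. split; [split; [apply Rmin_case; lra|lra]|].
intros z Hz. eapply Rle_trans; [apply H; lra|].
apply Rmult_le_compat_r; [apply pow_le; lra|apply Rle_abs].
Qed.

Lemma jet2_ext_loc F G a0 a1 a2 d : 0 < d -> (forall z, 0 < Cmod z < d -> F z = G z) ->
  jet2 F a0 a1 a2 -> jet2 G a0 a1 a2.
Proof.
intros Hd E [K [e [He H]]]. exists K, (Rmin d e). split; [now apply Rmin_case|].
pose proof (Rmin_l d e). pose proof (Rmin_r d e).
intros z Hz. rewrite <- E by lra. apply H. lra.
Qed.

Lemma jet2_unique F a0 a1 a2 b0 b1 b2 :
  jet2 F a0 a1 a2 -> jet2 F b0 b1 b2 -> a0 = b0 /\ a1 = b1 /\ a2 = b2.
Proof.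
intros [K [d [Hd H]]] [M [e [He H']]].
destruct (cubic_unique (b0 - a0) (b1 - a1) (b2 - a2) (K + M) (Rmin d e)) as [E0 [E1 E2]].
- now apply Rmin_case.
- pose proof (Rmin_l d e). pose proof (Rmin_r d e). intros z Hz.
  replace (b0 - a0 + (b1 - a1) * z + (b2 - a2) * z ^ 2)%C
    with ((F z - (a0 + a1 * z + a2 * z ^ 2)) - (F z - (b0 + b1 * z + b2 * z ^ 2)))%C by ring.
  eapply Rle_trans; [apply Cmod_triangle_minus|].
  specialize (H z ltac:(lra)). specialize (H' z ltac:(lra)). lra.
- repeat split; symmetry; now apply Ceq_minus.
Qed.

Lemma jet2_plus F G a0 a1 a2 b0 b1 b2 :
  jet2 F a0 a1 a2 -> jet2 G b0 b1 b2 ->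
  jet2 (fun z => F z + G z)%C (a0 + b0) (a1 + b1) (a2 + b2).
Proof.
intros [K [d [Hd H]]] [M [e [He H']]]. exists (K + M), (Rmin d e).
split; [now apply Rmin_case|].
pose proof (Rmin_l d e). pose proof (Rmin_r d e). intros z Hz.
replace (F z + G z - (a0 + b0 + (a1 + b1) * z + (a2 + b2) * z ^ 2))%C
  with ((F z - (a0 + a1 * z + a2 * z ^ 2)) + (G z - (b0 + b1 * z + b2 * z ^ 2)))%C by ring.
eapply Rle_trans; [apply Cmod_triangle|].
specialize (H z ltac:(lra)). specialize (H' z ltac:(lra)). lra.
Qed.

Lemma quadratic_bound (a0 a1 a2 z : C) : Cmod z <= 1 ->
  Cmod (a0 + a1 * z + a2 * z ^ 2) <= Cmod a0 + Cmod a1 + Cmod a2.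
Proof.
intros Hz. pose proof (Cmod_ge_0 z). pose proof (Cmod_ge_0 a1). pose proof (Cmod_ge_0 a2).
eapply Rle_trans; [apply Cmod_triangle|]. rewrite Cmod_mult, Cmod_pow.
pose proof (Cmod_triangle a0 (a1 * z)) as H3. rewrite Cmod_mult in H3.
assert (Cmod z ^ 2 <= 1) by (simpl; nra). nra.
Qed.

Lemma jet2_mult F G a0 a1 a2 b0 b1 b2 :
  jet2 F a0 a1 a2 -> jet2 G b0 b1 b2 ->
  jet2 (fun z => F z * G z)%C (a0 * b0) (a0 * b1 + a1 * b0) (a0 * b2 + a1 * b1 + a2 * b0).
Proof.
intros HF HG. apply jet2_near in HF. apply jet2_near in HG.
destruct HF as [K [d [HK [Hd H]]]]. destruct HG as [M [e [HM [He H']]]].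
set (A := Cmod a0 + Cmod a1 + Cmod a2). set (B := Cmod b0 + Cmod b1 + Cmod b2).
exists (K * (B + M) + A * M + (Cmod (a1 * b2 + a2 * b1) + Cmod (a2 * b2))), (Rmin d e).
split; [apply Rmin_case; lra|].
pose proof (Rmin_l d e). pose proof (Rmin_r d e). intros z Hz.
specialize (H z ltac:(lra)). specialize (H' z ltac:(lra)).
set (P := (a0 + a1 * z + a2 * z ^ 2)%C) in *. set (Q := (b0 + b1 * z + b2 * z ^ 2)%C) in *.
assert (HP : Cmod P <= A) by (apply quadratic_bound; lra).
assert (HQ : Cmod Q <= B) by (apply quadratic_bound; lra).
set (t := Cmod z) in *.
assert (Ht3 : 0 <= t ^ 3 <= 1).
{ split; [apply pow_le; lra|]. rewrite <- (pow1 3). apply pow_incr; lra. }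
assert (HGz : Cmod (G z) <= B + M).
{ replace (G z) with ((G z - Q) + Q)%C by ring. eapply Rle_trans; [apply Cmod_triangle|]. nra. }
replace (F z * G z - (a0 * b0 + (a0 * b1 + a1 * b0) * z + (a0 * b2 + a1 * b1 + a2 * b0) * z ^ 2))%C
  with ((F z - P) * G z + P * (G z - Q) + z ^ 3 * ((a1 * b2 + a2 * b1) + a2 * b2 * z))%C
  by (unfold P, Q; ring).
eapply Rle_trans; [apply Cmod_triangle|].
eapply Rle_trans; [apply Rplus_le_compat_r, Cmod_triangle|].
rewrite 2!Rmult_plus_distr_r.
apply Rplus_le_compat; [apply Rplus_le_compat|].
- rewrite Cmod_mult. replace (K * (B + M) * t ^ 3) with (K * t ^ 3 * (B + M)) by ring.
  apply Rmult_le_compat; try apply Cmod_ge_0; assumption.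
- rewrite Cmod_mult, Rmult_assoc. apply Rmult_le_compat; try apply Cmod_ge_0; assumption.
- rewrite Cmod_mult, Cmod_pow. fold t. rewrite Rmult_comm. apply Rmult_le_compat_r; [easy|].
  eapply Rle_trans; [apply Cmod_triangle|]. rewrite (Cmod_mult (a2 * b2)). fold t.
  pose proof (Cmod_ge_0 (a2 * b2)). nra.
Qed.

Lemma jet2_const c : jet2 (fun _ => c) c 0 0.
Proof.
exists 0, 1. split; [lra|]. intros z _.
replace (c - (c + 0 * z + 0 * z ^ 2))%C with (RtoC 0) by ring. rewrite Cmod_0. lra.
Qed.

Lemma jet2_id : jet2 (fun z => z) 0 1 0.
Proof.
exists 0, 1. split; [lra|]. intros z _.
replace (z - (0 + 1 * z + 0 * z ^ 2))%C with (RtoC 0) by ring. rewrite Cmod_0. lra.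
Qed.

(** * The complex exponential *)

(** Mean value theorem; iterating it gives Taylor estimates without Taylor's formula. *)
Lemma primitive_bound (g dg : R -> R) K k :
  g 0 = 0 -> (forall x, is_derive g x (dg x)) ->
  (forall x, Rabs x <= 1 -> Rabs (dg x) <= K * Rabs x ^ k) -> 0 <= K ->
  forall x, Rabs x <= 1 -> Rabs (g x) <= K * Rabs x ^ S k.
Proof.
intros H0 Hd Hb HK x Hx.
destruct (MVT_gen g 0 x dg) as [c [Hc E]].
- intros y _. apply Hd.
- intros y _. apply continuity_pt_filterlim. apply (ex_derive_continuous g). now exists (dg y).
- rewrite H0, Rminus_0_r, Rminus_0_r in E. rewrite E, Rabs_mult.
  assert (Hcx : Rabs c <= Rabs x).
  { destruct (Rle_dec 0 x).
    - rewrite Rmin_left, Rmax_right in Hc by lra. rewrite !Rabs_pos_eq; lra.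
    - rewrite Rmin_right, Rmax_left in Hc by lra. rewrite !Rabs_left1; lra. }
  simpl. rewrite (Rmult_comm (Rabs x)), <- Rmult_assoc.
  apply Rmult_le_compat_r; [apply Rabs_pos|].
  eapply Rle_trans; [apply Hb; lra|]. apply Rmult_le_compat_l; [easy|].
  apply pow_incr. split; [apply Rabs_pos|easy].
Qed.

Lemma exp_taylor2 x : Rabs x <= 1 -> Rabs (exp x - (1 + x + x ^ 2 / 2)) <= 3 * Rabs x ^ 3.
Proof.
revert x. apply (primitive_bound _ (fun x => exp x - (1 + x))).
- rewrite exp_0. field.
- intros x. auto_derive; [trivial|field].
- apply (primitive_bound _ (fun x => exp x - 1)).
  + rewrite exp_0. ring.
  + intros x. auto_derive; [trivial|ring].
  + apply (primitive_bound _ (fun x => exp x)).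
    * rewrite exp_0. ring.
    * intros x. auto_derive; [trivial|ring].
    * intros x Hx. simpl. rewrite Rabs_pos_eq by (apply Rlt_le, exp_pos).
      rewrite Rmult_1_r. eapply Rle_trans; [|apply exp_le_3].
      apply Rabs_le_between in Hx. destruct (Rle_lt_or_eq_dec x 1) as [H| ->]; [lra| |lra].
      now apply Rlt_le, exp_increasing.
    * lra.
  + lra.
- lra.
Qed.

Lemma sin_cos_taylor x : Rabs x <= 1 ->
  Rabs (sin x - x) <= Rabs x ^ 3 /\ Rabs (cos x - (1 - x ^ 2 / 2)) <= Rabs x ^ 3.
Proof.
assert (S1 : forall x, Rabs x <= 1 -> Rabs (sin x) <= 1 * Rabs x ^ 1).
{ apply (primitive_bound _ cos).
  - apply sin_0.
  - intros; auto_derive; [trivial|ring].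
  - intros y _. simpl. rewrite Rmult_1_r. apply Rabs_le. pose proof (COS_bound y). lra.
  - lra. }
assert (C1 : forall x, Rabs x <= 1 -> Rabs (cos x - 1) <= 1 * Rabs x ^ 2).
{ apply (primitive_bound _ (fun x => - sin x)).
  - rewrite cos_0. ring.
  - intros; auto_derive; [trivial|ring].
  - intros y Hy. rewrite Rabs_Ropp. now apply S1.
  - lra. }
assert (S2 : forall x, Rabs x <= 1 -> Rabs (sin x - x) <= 1 * Rabs x ^ 3).
{ apply (primitive_bound _ (fun x => cos x - 1)).
  - rewrite sin_0. ring.
  - intros; auto_derive; [trivial|ring].
  - exact C1.
  - lra. }
assert (C2 : forall x, Rabs x <= 1 -> Rabs (cos x - (1 - x ^ 2 / 2)) <= 1 * Rabs x ^ 4).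
{ apply (primitive_bound _ (fun x => x - sin x)).
  - rewrite cos_0. field.
  - intros; auto_derive; [trivial|field].
  - intros y Hy. rewrite Rabs_minus_sym. now apply S2.
  - lra. }
intros Hx. split.
- rewrite <- (Rmult_1_l (_ ^ 3)). now apply S2.
- eapply Rle_trans; [now apply C2|]. rewrite Rmult_1_l. simpl.
  pose proof (Rabs_pos x). assert (0 <= Rabs x ^ 3) by now apply pow_le. simpl in *. nra.
Qed.

Lemma Cexp_taylor2 (u : C) : Cmod u <= 1 ->
  Cmod (Cexp u - (1 + u + u ^ 2 / 2)) <= 20 * Cmod u ^ 3.
Proof.
intros Hu. destruct u as [x y].
assert (Hm := Rmax_Cmod (x, y)). simpl fst in Hm; simpl snd in Hm.
set (t := Cmod (x, y)) in *.
assert (Hx : Rabs x <= t) by (eapply Rle_trans; [apply Rmax_l|exact Hm]).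
assert (Hy : Rabs y <= t) by (eapply Rle_trans; [apply Rmax_r|exact Hm]).
assert (Ht0 : 0 <= t) by apply Cmod_ge_0.
assert (Px : Rabs x ^ 3 <= t ^ 3) by (apply pow_incr; split; [apply Rabs_pos|easy]).
assert (Py : Rabs y ^ 3 <= t ^ 3) by (apply pow_incr; split; [apply Rabs_pos|easy]).
destruct (sin_cos_taylor y) as [Hs Hc]; [lra|]. assert (He := exp_taylor2 x ltac:(lra)).
set (r1 := exp x - (1 + x + x ^ 2 / 2)) in *. set (r2 := cos y - (1 - y ^ 2 / 2)) in *.
set (r3 := sin y - y) in *.
assert (Ht3 : 0 <= t ^ 3) by now apply pow_le.
assert (E1 : Rabs r1 <= 3 * t ^ 3) by lra. assert (E2 : Rabs r2 <= t ^ 3) by lra.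
assert (E3 : Rabs r3 <= t ^ 3) by lra.
assert (Q : Rabs (1 + x + x ^ 2 / 2) <= 5 / 2).
{ eapply Rle_trans; [apply Rabs_triang|].
  eapply Rle_trans; [apply Rplus_le_compat_r, Rabs_triang|].
  rewrite Rabs_R1, (Rabs_pos_eq (x ^ 2 / 2)) by nra.
  rewrite <- (pow2_abs x). pose proof (Rabs_pos x). nra. }
assert (Mono : forall a b c, Rabs a <= t -> Rabs b <= t -> Rabs c <= t -> Rabs (a * b * c) <= t ^ 3).
{ intros a b c Ha Hb Hcc. rewrite !Rabs_mult.
  replace (t ^ 3) with (t * t * t) by ring.
  apply Rmult_le_compat; try apply Rabs_pos; try assumption.
  - apply Rmult_le_pos; apply Rabs_pos.
  - apply Rmult_le_compat; try apply Rabs_pos; assumption. }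
eapply Rle_trans; [apply Cmod_le_abs|].
assert (RE : Rabs (exp x * cos y - (1 + x + (x ^ 2 - y ^ 2) / 2)) <= 9 * t ^ 3).
{ replace (exp x * cos y - (1 + x + (x ^ 2 - y ^ 2) / 2))
    with (r1 * cos y + (1 + x + x ^ 2 / 2) * r2 + - (1 / 2 * (x * y * y) + 1 / 4 * (x * y * y) * x))
    by (unfold r1, r2; field).
  eapply Rle_trans; [apply Rabs_triang|].
  eapply Rle_trans; [apply Rplus_le_compat_r, Rabs_triang|].
  rewrite Rabs_Ropp.
  assert (A1 : Rabs (r1 * cos y) <= 3 * t ^ 3).
  { rewrite Rabs_mult. assert (Rabs (cos y) <= 1) by (apply Rabs_le; pose proof (COS_bound y); lra).
    pose proof (Rabs_pos r1). nra. }
  assert (A2 : Rabs ((1 + x + x ^ 2 / 2) * r2) <= 5 / 2 * t ^ 3).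
  { rewrite Rabs_mult. apply Rmult_le_compat; try apply Rabs_pos; assumption. }
  assert (A3 := Mono x y y Hx Hy Hy).
  assert (A4 : Rabs (1 / 2 * (x * y * y) + 1 / 4 * (x * y * y) * x) <= t ^ 3).
  { eapply Rle_trans; [apply Rabs_triang|].
    rewrite (Rabs_mult (1 / 2)), (Rabs_mult (1 / 4 * (x * y * y))), (Rabs_mult (1 / 4)).
    rewrite (Rabs_pos_eq (1 / 2)), (Rabs_pos_eq (1 / 4)) by lra.
    pose proof (Rabs_pos (x * y * y)). pose proof (Rabs_pos x). nra. }
  lra. }
assert (IM : Rabs (exp x * sin y - (y + x * y)) <= 11 * t ^ 3).
{ replace (exp x * sin y - (y + x * y))
    with (r1 * sin y + (1 + x + x ^ 2 / 2) * r3 + 1 / 2 * (x * x * y))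
    by (unfold r1, r3; field).
  eapply Rle_trans; [apply Rabs_triang|].
  eapply Rle_trans; [apply Rplus_le_compat_r, Rabs_triang|].
  assert (A1 : Rabs (r1 * sin y) <= 3 * t ^ 3).
  { rewrite Rabs_mult. assert (Rabs (sin y) <= 1) by (apply Rabs_le; pose proof (SIN_bound y); lra).
    pose proof (Rabs_pos r1). nra. }
  assert (A2 : Rabs ((1 + x + x ^ 2 / 2) * r3) <= 5 / 2 * t ^ 3).
  { rewrite Rabs_mult. apply Rmult_le_compat; try apply Rabs_pos; assumption. }
  assert (A3 := Mono x x y Hx Hx Hy).
  rewrite (Rabs_mult (1 / 2)), (Rabs_pos_eq (1 / 2)) by lra. lra. }
match goal with |- Rabs ?a + Rabs ?b <= _ =>
  replace a with (exp x * cos y - (1 + x + (x ^ 2 - y ^ 2) / 2));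
  [replace b with (exp x * sin y - (y + x * y)); [lra|]|] end.
- simpl. field.
- simpl. field.
Qed.

Lemma Cexp_plus a b : Cexp (a + b) = (Cexp a * Cexp b)%C.
Proof.
destruct a, b. unfold Cexp, Cmult, Re, Im; simpl. rewrite exp_plus, cos_plus, sin_plus. f_equal; ring.
Qed.

Lemma Cexp_0 : Cexp 0 = 1%C.
Proof. unfold Cexp, Re, Im; simpl. rewrite exp_0, cos_0, sin_0, Rmult_1_l, Rmult_0_r. reflexivity. Qed.

Lemma cderiv_Cexp z : is_cderiv Cexp z (Cexp z).
Proof.
apply cderiv_quadratic with (Cmod (Cexp z) * 21) 1; [lra|]. intros w Hw.
set (h := (w - z)%C) in *.
replace w with (z + h)%C by (unfold h; ring). rewrite Cexp_plus.
replace (Cexp z * Cexp h - Cexp z - Cexp z * h)%C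
  with (Cexp z * ((Cexp h - (1 + h + h ^ 2 / 2)) + h ^ 2 / 2))%C by field.
rewrite Cmod_mult, Rmult_assoc. apply Rmult_le_compat_l; [apply Cmod_ge_0|].
eapply Rle_trans; [apply Cmod_triangle|].
assert (H := Cexp_taylor2 h ltac:(lra)). pose proof (Cmod_ge_0 h).
assert (E : Cmod (h ^ 2 / 2) = Cmod h ^ 2 / 2).
{ rewrite Cmod_div, Cmod_pow, Cmod_R, Rabs_pos_eq; [reflexivity|lra|].
  intros E. apply RtoC_inj in E. lra. }
rewrite E. simpl in *. nra.
Qed.

(** [Cexp u = 1 + u + u^2 / 2 + O(u^3)] and [u = F z = O(z)]. *)
Lemma jet2_Cexp F b1 b2 :
  jet2 F 0 b1 b2 -> jet2 (fun z => Cexp (F z)) 1 b1 (b2 + b1 * b1 / 2).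
Proof.
intros HF.
assert (H1 : jet2 (fun z => 1 + F z + / 2 * (F z * F z))%C 1 b1 (b2 + b1 * b1 / 2)).
{ assert (A := jet2_plus _ _ _ _ _ _ _ _ (jet2_const 1) HF).
  assert (B := jet2_mult _ _ _ _ _ _ _ _ (jet2_const (/ 2)) (jet2_mult _ _ _ _ _ _ _ _ HF HF)).
  assert (D := jet2_plus _ _ _ _ _ _ _ _ A B).
  match type of D with jet2 _ ?x ?y ?w =>
    replace x with (RtoC 1) in D by ring; replace y with b1 in D by ring;
    replace w with (b2 + b1 * b1 / 2)%C in D by (field; intros E; apply RtoC_inj in E; lra) end.
  exact D. }
apply jet2_near in HF. destruct HF as [K [d [HK [Hd HF]]]].
destruct H1 as [M [e [He H1]]].
set (B := Cmod b1 + Cmod b2 + K). 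
assert (HB : 0 <= B) by (unfold B; pose proof (Cmod_ge_0 b1); pose proof (Cmod_ge_0 b2); lra).
set (d' := Rmin e (Rmin d (/ (B + 1)))).
assert (Hd1 : d' <= e) by apply Rmin_l.
assert (Hd2 : d' <= d) by (eapply Rle_trans; [apply Rmin_r|apply Rmin_l]).
assert (Hd3 : d' <= / (B + 1)) by (eapply Rle_trans; [apply Rmin_r|apply Rmin_r]).
exists (20 * B ^ 3 + M), d'. split.
{ repeat apply Rmin_case; try lra. apply Rinv_0_lt_compat; lra. }
intros z Hz. specialize (HF z ltac:(lra)). specialize (H1 z ltac:(lra)).
assert (HFz : Cmod (F z) <= B * Cmod z).
{ replace (F z) with ((F z - (0 + b1 * z + b2 * z ^ 2)) + z * (b1 + b2 * z))%C by ring.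
  eapply Rle_trans; [apply Cmod_triangle|]. rewrite Cmod_mult.
  pose proof (Cmod_triangle b1 (b2 * z)) as T. rewrite Cmod_mult in T.
  pose proof (Cmod_ge_0 b2).
  assert (Cmod z ^ 3 <= Cmod z) by (simpl; assert (Cmod z * Cmod z <= 1) by nra; nra).
  assert (Cmod b1 + Cmod b2 * Cmod z <= Cmod b1 + Cmod b2) by nra.
  unfold B. nra. }
assert (HF1 : Cmod (F z) <= 1).
{ eapply Rle_trans; [exact HFz|]. 
  apply Rle_trans with (B * / (B + 1)); [apply Rmult_le_compat_l; lra|].
  apply Rmult_le_reg_r with (B + 1); [lra|]. rewrite Rmult_assoc, Rinv_l; lra. }
replace (Cexp (F z) - (1 + b1 * z + (b2 + b1 * b1 / 2) * z ^ 2))%C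
  with ((Cexp (F z) - (1 + F z + F z ^ 2 / 2)) +
    (1 + F z + / 2 * (F z * F z) - (1 + b1 * z + (b2 + b1 * b1 / 2) * z ^ 2)))%C
  by (field; intros E; apply RtoC_inj in E; lra).
eapply Rle_trans; [apply Cmod_triangle|].
rewrite Rmult_plus_distr_r. apply Rplus_le_compat; [|exact H1].
eapply Rle_trans; [now apply Cexp_taylor2|].
rewrite Rmult_assoc, <- Rpow_mult_distr. apply Rmult_le_compat_l; [lra|].
apply pow_incr. split; [apply Cmod_ge_0|exact HFz].
Qed.

(** * Functions with positive real part *)

(** Integrate [Re p >= 0] against [|q|^2] over the circle of radius [r], where
    [q = 1 + x1 e + x2 e^2] and [e] is the point of the unit circle.  The negative frequencies of
    [|q|^2] pick out the coefficients of [p]; the positive ones integrate to 0 against [p] by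
    Cauchy's theorem. *)
Lemma toeplitz_form (p : C -> C) (c : nat -> C) (r : R) (x1 x2 : C) :
  (forall z, Cmod z < 1 -> exists l, is_cderiv p z l) ->
  (forall (r : R) k, 0 < r < 1 ->
     is_CInt (fun y => p (r * unit_circle y) * (/ (r * unit_circle y)) ^ k)%C 0 1 (c k)) ->
  (forall z, Cmod z < 1 -> 0 <= Re (p z)) ->
  0 < r < 1 ->
  0 <= Re ((1 + x1 * Cconj x1 + x2 * Cconj x2) * c 0%nat
    + (Cconj x1 + x1 * Cconj x2) * (r * c 1%nat) + Cconj x2 * (r ^ 2 * c 2%nat)).
Proof.
intros Hp Hc Hpos Hr.
assert (Hpos_freq : forall k,
  is_CInt (fun y => p (r * unit_circle y) * (r * unit_circle y) ^ S k)%C 0 1 0).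
{ intros k.
  assert (HG : forall z : C, Cmod z <= r -> exists l, is_cderiv (fun w => p w * w ^ k)%C z l).
  { intros z Hz. destruct (Hp z) as [l Hl]; [lra|]. eexists.
    apply cderiv_mult; [exact Hl|apply cderiv_pow]. }
  rewrite <- (cauchy_disk (fun w => p w * w ^ k)%C r) by (lra || exact HG).
  apply is_CInt_ext with (fun y => p (0 + r * unit_circle y) * (0 + r * unit_circle y) ^ k
    * (r * unit_circle y))%C.
  - intros t _. rewrite Cplus_0_l. simpl Cpow. ring.
  - apply (circle_integral_correct (fun w => p w * w ^ k)%C). intros y _. apply HG.
    rewrite Cplus_0_l, Cmod_r_unit_circle; lra. }
set (w0 := (1 + x1 * Cconj x1 + x2 * Cconj x2)%C).
set (wm1 := (Cconj x1 + x1 * Cconj x2)%C). set (wm2 := Cconj x2).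
set (w1 := (x1 + x2 * Cconj x1)%C). set (w2 := x2).
set (W := fun y => let e := unit_circle y in
  ((1 + x1 * e + x2 * e ^ 2) * Cconj (1 + x1 * e + x2 * e ^ 2))%C).
assert (HI : is_CInt (fun y => p (r * unit_circle y) * W y)%C 0 1
  (w0 * c 0%nat + wm1 * (r * c 1%nat) + wm2 * (r ^ 2 * c 2%nat))).
{ replace (w0 * c 0%nat + wm1 * (r * c 1%nat) + wm2 * (r ^ 2 * c 2%nat))%C
    with (w0 * c 0%nat + (wm1 * r) * c 1%nat + (wm2 * r ^ 2) * c 2%nat
      + (w1 * / r) * 0 + (w2 * / r ^ 2) * 0)%C by ring.
  apply is_CInt_ext with (fun y =>
      w0 * (p (r * unit_circle y) * (/ (r * unit_circle y)) ^ 0)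
    + (wm1 * r) * (p (r * unit_circle y) * (/ (r * unit_circle y)) ^ 1)
    + (wm2 * r ^ 2) * (p (r * unit_circle y) * (/ (r * unit_circle y)) ^ 2)
    + (w1 * / r) * (p (r * unit_circle y) * (r * unit_circle y) ^ 1)
    + (w2 * / r ^ 2) * (p (r * unit_circle y) * (r * unit_circle y) ^ 2))%C.
  - intros t _.
    assert (Ht := unit_circle_neq_0 t).
    assert (Hconj : Cconj (unit_circle t) = (/ unit_circle t)%C).
    { assert (E : (unit_circle t * Cconj (unit_circle t))%C = 1%C).
      { rewrite <- Cmod2_conj, Cmod_unit_circle. rewrite pow1. reflexivity. }
      replace (Cconj (unit_circle t)) with (/ unit_circle t * (unit_circle t * Cconj (unit_circle t)))%C
        by (field; exact Ht).
      rewrite E. ring. }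
    assert (Hr0 : RtoC r <> 0%C) by (intros E; apply RtoC_inj in E; lra).
    unfold W. rewrite !Cplus_conj, !Cmult_conj, Cpow_conj, Hconj.
    replace (Cconj 1) with (RtoC 1) by (unfold Cconj; simpl; now rewrite Ropp_0).
    unfold w0, wm1, wm2, w1, w2. simpl Cpow. field. split; assumption.
  - apply is_CInt_plus; [apply is_CInt_plus; [apply is_CInt_plus; [apply is_CInt_plus|]|]|];
    apply is_CInt_scal.
    + now apply Hc.
    + now apply Hc.
    + now apply Hc.
    + apply (Hpos_freq 0%nat).
    + apply (Hpos_freq 1%nat). }
apply is_CInt_Re in HI.
change (0 <= fst (w0 * c 0%nat + wm1 * (r * c 1%nat) + wm2 * (r ^ 2 * c 2%nat))%C).
apply (is_RInt_le (fun _ => 0) _ 0 1 0 _ ltac:(lra)) in HI; [exact HI| |].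
- assert (H := is_RInt_const (V := R_NormedModule) 0 1 0).
  match type of H with is_RInt _ _ _ ?l =>
    replace l with 0 in H by (unfold scal; simpl; unfold mult; simpl; ring) end.
  exact H.
- intros y _. cbv beta.
  assert (HW : W y = RtoC (Cmod (1 + x1 * unit_circle y + x2 * unit_circle y ^ 2) ^ 2)).
  { unfold W. rewrite <- Cmod2_conj. now rewrite RtoC_pow. }
  rewrite HW. set (m := Cmod (1 + x1 * unit_circle y + x2 * unit_circle y ^ 2)).
  change (0 <= Re (p (r * unit_circle y)%C * RtoC (m ^ 2)%R)).
  rewrite re_scal_r. apply Rmult_le_pos; [|apply pow_le, Cmod_ge_0].
  apply Hpos. rewrite Cmod_r_unit_circle; lra.
Qed.

Lemma exists_opposite_phase (D : C) : exists u : C, Cmod u ^ 2 = 1 /\ Re (D * Cconj u) = - Cmod D.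
Proof.
destruct (Ceq_dec D 0) as [->|H].
- exists 1%C. rewrite Cmod_1, Cmod_0. split; [ring|]. simpl. ring.
- apply Cmod_gt_0 in H. exists (- D * RtoC (/ Cmod D))%C.
  rewrite Cmod_mult, Cmod_opp, Cmod_R, Rabs_pos_eq by (apply Rlt_le, Rinv_0_lt_compat, H).
  split; [field; lra|].
  rewrite Cmult_conj, Copp_conj.
  replace (Cconj (RtoC (/ Cmod D))) with (RtoC (/ Cmod D)).
  2:{ unfold Cconj, RtoC; simpl. now rewrite Ropp_0. }
  replace (D * (- Cconj D * RtoC (/ Cmod D)))%C with (RtoC (- / Cmod D) * (D * Cconj D))%C.
  2:{ rewrite RtoC_opp. ring. }
  rewrite <- Cmod2_conj, <- RtoC_mult, re_RtoC. field. lra.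
Qed.

(** Minimise the Toeplitz form over the middle variable [x1], which leaves a form in two variables
    whose off-diagonal entry is [c2 - c1^2 / 2] and whose diagonal entries are [2 - |c1|^2 / 2].
    The phase of [u] makes the off-diagonal term as negative as possible.  This is done on
    circles of radius [r < 1], and [r] then tends to 1. *)
Lemma caratheodory (p : C -> C) (c : nat -> C) :
  (forall z, Cmod z < 1 -> exists l, is_cderiv p z l) ->
  (forall (r : R) k, 0 < r < 1 ->
     is_CInt (fun y => p (r * unit_circle y) * (/ (r * unit_circle y)) ^ k)%C 0 1 (c k)) ->
  (forall z, Cmod z < 1 -> 0 <= Re (p z)) ->
  c 0%nat = 1%C ->
  Cmod (c 2%nat - c 1%nat ^ 2 / 2) <= 2 - Cmod (c 1%nat) ^ 2 / 2.
Proof.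
intros Hp Hc Hpos Hc0.
set (D := (c 2%nat - c 1%nat ^ 2 / 2)%C).
assert (H : forall r, 0 < r < 1 -> r ^ 2 * (Cmod D + Cmod (c 1%nat) ^ 2 / 2) <= 2).
{ intros r Hr. destruct (exists_opposite_phase D) as [u [Hu HD]].
  set (a := (r * c 1%nat)%C).
  (* [x1 = - (a + conj a u) / 2] minimises the form, [x2 = u] having the phase chosen above. *)
  assert (T := toeplitz_form p c r (- (a + Cconj a * u) / 2) u Hp Hc Hpos Hr).
  rewrite Hc0 in T. fold a in T.
  assert (Ea : Cmod a ^ 2 = r ^ 2 * Cmod (c 1%nat) ^ 2).
  { unfold a. rewrite Cmod_mult, Cmod_R, Rabs_pos_eq by lra. ring. }
  assert (ED : (r ^ 2 * c 2%nat)%C = (r ^ 2 * D + a ^ 2 / 2)%C).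
  { unfold D, a. field. }
  rewrite ED in T.
  assert (Hre : Re ((r ^ 2 * D) * Cconj u) = - (r ^ 2 * Cmod D)).
  { replace (r ^ 2 * D * Cconj u)%C with (RtoC (r ^ 2) * (D * Cconj u))%C by (rewrite RtoC_pow; ring).
    rewrite re_scal_l, HD. ring. }
  set (b := (r ^ 2 * D)%C) in *. clearbody b a.
  assert (Id : Re ((1 + - (a + Cconj a * u) / 2 * Cconj (- (a + Cconj a * u) / 2) + u * Cconj u) * 1
      + (Cconj (- (a + Cconj a * u) / 2) + - (a + Cconj a * u) / 2 * Cconj u) * a
      + Cconj u * (b + a ^ 2 / 2))
    = 1 + Cmod u ^ 2 - Cmod a ^ 2 * (1 + Cmod u ^ 2) / 4 + Re (b * Cconj u)).
  { rewrite !Cmod2_alt. destruct a as [a1 a2], u as [u1 u2], b as [b1 b2].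
    unfold Re, Im; simpl. field. }
  rewrite Id, Hu, Hre, Ea in T. lra. }
fold D. set (X := Cmod D + Cmod (c 1%nat) ^ 2 / 2) in *.
destruct (Rle_dec X 2) as [|Hn]; [unfold X in *; lra|exfalso].
(* If [X > 2], some [r^2 = m < 1] still has [m X > 2]. *)
set (m := (2 / X + 1) / 2).
assert (HX : 2 / X < 1).
{ apply Rmult_lt_reg_r with X; [lra|]. unfold Rdiv. rewrite Rmult_assoc, Rinv_l; lra. }
assert (HX0 : 0 < 2 / X) by (apply Rdiv_lt_0_compat; lra).
assert (Hm : 0 < m < 1) by (unfold m; lra).
specialize (H (sqrt m)).
assert (Hs : 0 < sqrt m < 1).
{ split; [apply sqrt_lt_R0; lra|]. rewrite <- sqrt_1. apply sqrt_lt_1_alt. lra. }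
specialize (H Hs). rewrite pow2_sqrt in H by lra.
assert (E : 2 / X * X = 2) by (field; lra). unfold m in H. nra.
Qed.

(** * Coefficients of the class and of the logarithm *)

Lemma ps_C_derive a rho F :
  0 < rho -> (forall w, Cmod w < rho -> is_ps a w (F w)) ->
  forall z, Cmod z < rho -> is_cderiv F z (C_derive F z) /\ is_ps (deriv_coef a) z (C_derive F z).
Proof.
intros Hrho HF z Hz.
assert (Ha : abs_conv a rho).
{ apply ps_abs_conv. intros w Hw. exists (F w). apply HF. lra. }
destruct (abs_conv_ps (deriv_coef a) rho z) as [l Hl]; [now apply abs_conv_deriv_coef|exact Hz|].
assert (Hd : is_cderiv F z l) by (apply ps_cderiv with a rho; assumption).
rewrite (cderiv_C_derive _ _ _ Hd). now split.
Qed.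

Lemma INR_2 : INR 2 = 2. Proof. simpl; ring. Qed.
Lemma INR_3 : INR 3 = 3. Proof. simpl; ring. Qed.

Definition W_density (alpha : R) (f : C -> C) (z : C) : C :=
  (C_derive f z + alpha * z * C_derive (C_derive f) z)%C.

Lemma jet2_W_density alpha f a :
  (forall z, Cmod z < 1 -> is_ps a z (f z)) ->
  jet2 (W_density alpha f) (a 1%nat) (2 * (1 + alpha) * a 2%nat) (3 * (1 + 2 * alpha) * a 3%nat).
Proof.
intros Ha.
assert (H1 := fun z Hz => proj2 (ps_C_derive a 1 f Rlt_0_1 Ha z Hz)).
assert (H2 := fun z Hz => proj2 (ps_C_derive _ 1 _ Rlt_0_1 H1 z Hz)).
assert (J1 := ps_jet2 _ 1 _ Rlt_0_1 (fun z Hz => H1 z (proj2 Hz))).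
assert (J2 := ps_jet2 _ 1 _ Rlt_0_1 (fun z Hz => H2 z (proj2 Hz))).
assert (J := jet2_plus _ _ _ _ _ _ _ _ J1
  (jet2_mult _ _ _ _ _ _ _ _ (jet2_mult _ _ _ _ _ _ _ _ (jet2_const alpha) jet2_id) J2)).
unfold deriv_coef in J. rewrite INR_2, INR_3 in J. change (INR 1) with 1 in J.
match type of J with jet2 _ ?x ?y ?w =>
  replace x with (a 1%nat) in J by ring;
  replace y with (2 * (1 + alpha) * a 2%nat)%C in J by ring;
  replace w with (3 * (1 + 2 * alpha) * a 3%nat)%C in J by ring end.
exact J.
Qed.

Lemma is_csum_zero : is_csum (fun _ => RtoC 0) 0.
Proof.
apply is_csum_eps. intros eps He. exists 0%nat. intros n _.
replace (sum_n (G := C_AbelianMonoid) (fun _ => RtoC 0) n) with (RtoC 0).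
- replace (0 - 0)%C with (RtoC 0) by ring. now rewrite Cmod_0.
- induction n; [now rewrite sum_O|]. rewrite sum_Sn, <- IHn.
  change (RtoC 0 = (0 + 0)%C). ring.
Qed.

Lemma is_ps_0 b w : is_ps b 0 w -> w = b 0%nat.
Proof.
intros Hw. apply (is_csum_unique _ _ _ Hw).
replace (b 0%nat) with (0 + b 0%nat * 0 ^ 0)%C by (simpl; ring).
apply (is_csum_cons (fun n => b n * 0 ^ n)%C).
apply is_csum_ext with (2 := is_csum_zero). intros n. simpl. ring.
Qed.

Lemma ps_div_z (a : nat -> C) (f : C -> C) (z : C) :
  a 0%nat = 0%C -> is_ps a z (f z) -> z <> 0%C -> is_ps (fun n => a (S n)) z (f z / z).
Proof.
intros Ha0 Ha Hn.
assert (H := is_csum_scal (/ z) _ _ (is_csum_tail _ _ Ha)). cbv beta in H.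
rewrite Ha0 in H. replace (/ z * (f z - 0 * z ^ 0))%C with (f z / z)%C in H by (field; exact Hn).
revert H. apply is_csum_ext. intros n. simpl. field. exact Hn.
Qed.

Lemma class_A_taylor f : class_A f ->
  exists a, (forall z, Cmod z < 1 -> is_ps a z (f z)) /\ a 0%nat = 0%C /\ a 1%nat = 1%C.
Proof.
intros [Hh [H0 H1]].
destruct (taylor_disk f 1 Rlt_0_1) as [a [Ha _]].
{ intros z Hz. now apply ex_derive_cderiv, Hh. }
assert (Hz0 : Cmod 0 < 1) by (rewrite Cmod_0; lra).
exists a. split; [exact Ha|]. split.
- rewrite <- (is_ps_0 a (f 0)); [exact H0|now apply Ha].
- assert (E := is_ps_0 _ _ (proj2 (ps_C_derive a 1 f Rlt_0_1 Ha 0%C Hz0))).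
  rewrite H1 in E. unfold deriv_coef in E. change (INR 1) with 1 in E. rewrite Cmult_1_l in E.
  now symmetry.
Qed.

(** The class condition involves [C_derive (C_derive f)], which is meaningful only because [f] is
    a power series; the same fact makes the density holomorphic, so that [caratheodory] applies. *)
Lemma class_W_coefficients alpha f : class_W alpha f ->
  exists a, (forall z, Cmod z < 1 -> is_ps a z (f z)) /\ a 0%nat = 0%C /\ a 1%nat = 1%C /\
    let c1 := (2 * (1 + alpha) * a 2%nat)%C in
    let c2 := (3 * (1 + 2 * alpha) * a 3%nat)%C in
    Cmod (c2 - c1 ^ 2 / 2) <= 2 - Cmod c1 ^ 2 / 2.
Proof.
intros [HA HW]. destruct (class_A_taylor f HA) as [a [Ha [Ha0 Ha1]]].
exists a. split; [exact Ha|]. split; [exact Ha0|]. split; [exact Ha1|].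
set (p := W_density alpha f).
assert (D1 := ps_C_derive a 1 f Rlt_0_1 Ha).
assert (D2 := ps_C_derive _ 1 _ Rlt_0_1 (fun z Hz => proj2 (D1 z Hz))).
assert (D3 := ps_C_derive _ 1 _ Rlt_0_1 (fun z Hz => proj2 (D2 z Hz))).
assert (Hp : forall z, Cmod z < 1 -> exists l, is_cderiv p z l).
{ intros z Hz. eexists. apply cderiv_plus; [apply (D2 z Hz)|].
  apply (cderiv_mult (fun z => alpha * z)%C (C_derive (C_derive f))); [|apply (D3 z Hz)].
  apply cderiv_scal, cderiv_id. }
destruct (taylor_disk p 1 Rlt_0_1 Hp) as [c [Hc1 Hc2]].
assert (J1 := jet2_W_density alpha f a Ha).
assert (J2 := ps_jet2 c 1 p Rlt_0_1 (fun z Hz => Hc1 z (proj2 Hz))).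
destruct (jet2_unique _ _ _ _ _ _ _ J1 J2) as [E0 [E1 E2]].
cbv zeta. rewrite E1, E2. apply (caratheodory p c Hp Hc2).
- intros z Hz. apply Rlt_le. apply HW, Hz.
- rewrite <- E0. exact Ha1.
Qed.

(** Near 0 the function [f z / z = 1 + a2 z + a3 z^2 + ...] is the exponential of twice the
    logarithmic series.  Comparing coefficients gives [a2 = 2 gamma_1] and
    [a3 = 2 gamma_2 + 2 gamma_1^2]. *)
Lemma log_coefficients_values f gamma a :
  (forall z, Cmod z < 1 -> is_ps a z (f z)) -> a 0%nat = 0%C -> a 1%nat = 1%C ->
  log_coefficients f gamma ->
  gamma 1%nat = (a 2%nat / 2)%C /\ gamma 2%nat = ((a 3%nat - a 2%nat ^ 2 / 2) / 2)%C.
Proof.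
intros Ha Ha0 Ha1 [r [Hr Hg]].
assert (J1 : jet2 (fun z => f z / z)%C (a 1%nat) (a 2%nat) (a 3%nat)).
{ apply (ps_jet2 (fun n => a (S n)) 1); [lra|]. intros z [Hz0 Hz].
  apply ps_div_z; [exact Ha0|now apply Ha|now apply Cmod_gt_0]. }
set (g := fun n => match n with O => RtoC 0 | S m => gamma n end).
(* The hypothesis gives a sum at each point separately; [L] collects them into a function. *)
set (L := fun z => epsilon (inhabits (RtoC 0)) (fun l => is_ps g z l)).
assert (HL : forall z, 0 < Cmod z < r -> is_ps g z (L z) /\ Cexp (2 * L z) = (f z / z)%C).
{ intros z Hz. destruct (Hg z Hz) as [l [Hl He]].
  assert (Hl' : is_ps g z l).
  { replace l with (l + g 0%nat * z ^ 0)%C by (simpl; ring).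
    apply (is_csum_cons (fun n => g n * z ^ n)%C). exact Hl. }
  assert (HLz : is_ps g z (L z)).
  { unfold L. apply epsilon_spec. now exists l. }
  split; [exact HLz|]. now rewrite (is_csum_unique _ _ _ HLz Hl'). }
assert (J2 := ps_jet2 g r L Hr (fun z Hz => proj1 (HL z Hz))).
assert (J3 := jet2_mult _ _ _ _ _ _ _ _ (jet2_const 2) J2). simpl in J3.
match type of J3 with jet2 _ ?x ?y ?w =>
  replace x with (RtoC 0) in J3 by ring; replace y with (2 * gamma 1%nat)%C in J3 by ring;
  replace w with (2 * gamma 2%nat)%C in J3 by ring end.
apply jet2_Cexp in J3.
apply (jet2_ext_loc _ (fun z => f z / z)%C _ _ _ r Hr) in J3; [|intros z Hz; now apply HL].
destruct (jet2_unique _ _ _ _ _ _ _ J1 J3) as [_ [E1 E2]].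
split.
- rewrite E1. field.
- rewrite E1, E2. field.
Qed.

(** * The inequalities *)

(** [4 D - E^2 = 11 + 4 alpha - 4 alpha^2 = 4 (3 - (alpha - 1 / 2)^2)]. *)
Lemma threshold_spec alpha : 0 <= alpha ->
  alpha <= threshold <-> (3 * (1 + 2 * alpha)) ^ 2 <= 4 * (8 * alpha ^ 2 + 10 * alpha + 5).
Proof.
intros Ha. unfold threshold.
assert (Hs := sqrt_sqrt 3 ltac:(lra)). assert (Hs0 := sqrt_pos 3).
assert (Hs1 : 1 <= sqrt 3) by nra.
split; intros H.
- assert (0 <= (sqrt 3 - (alpha - 1 / 2)) * (sqrt 3 + (alpha - 1 / 2))) by (apply Rmult_le_pos; lra).
  nra.
- destruct (Rle_dec alpha (1 / 2 + sqrt 3)); [assumption|exfalso].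
  assert (0 < (alpha - 1 / 2 - sqrt 3) * (alpha - 1 / 2 + sqrt 3)) by (apply Rmult_lt_0_compat; lra).
  nra.
Qed.

Lemma decimal_le_threshold : 2232 / 1000 <= threshold.
Proof.
unfold threshold. assert (Hs := sqrt_sqrt 3 ltac:(lra)). assert (Hs0 := sqrt_pos 3). nra.
Qed.

(** The minimum of the parabola [(D u^2 - 1) / E - u], at its vertex [u = E / (2 D)]. *)
Lemma gap_ge_second_bound D E u G : 0 < D -> 0 < E -> (D * u ^ 2 - 1) / E <= G ->
  - (1 / E) - E / (4 * D) <= G - u.
Proof.
intros HD HE HG.
assert (H : 0 <= D / E * (u - E / (2 * D)) ^ 2).
{ apply Rmult_le_pos; [apply Rlt_le, Rdiv_lt_0_compat; lra|apply pow2_ge_0]. }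
replace (D / E * (u - E / (2 * D)) ^ 2) with ((D * u ^ 2 - 1) / E - u + 1 / E + E / (4 * D)) in H
  by (field; lra).
lra.
Qed.

(** Up to [u = 1 / sqrt D] use [0 <= G].  Beyond this zero of [(D u^2 - 1) / E] the parabola
    [(D u^2 - 1) / E - u] is increasing, because its vertex [E / (2 D)] comes before it. *)
Lemma gap_ge_first_bound D E u G : 0 < D -> 0 < E -> E ^ 2 <= 4 * D -> 0 <= G ->
  (D * u ^ 2 - 1) / E <= G -> - (1 / sqrt D) <= G - u.
Proof.
intros HD HE HED HG0 HG.
assert (Hs : 0 < sqrt D) by now apply sqrt_lt_R0.
set (v := 1 / sqrt D).
assert (Hv : 0 < v) by (apply Rdiv_lt_0_compat; lra).
assert (HDv : D * v = sqrt D).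
{ unfold v. rewrite <- (sqrt_sqrt D) at 1 by lra. field. lra. }
destruct (Rle_dec u v) as [Hle|Hgt]; [lra|].
assert (HE2 : E <= 2 * sqrt D).
{ apply Rsqr_incr_0_var; [|lra]. unfold Rsqr.
  replace (2 * sqrt D * (2 * sqrt D)) with (4 * (sqrt D * sqrt D)) by ring.
  rewrite sqrt_sqrt by lra. lra. }
assert (H : 0 <= (u - v) * ((D * (u + v) - E) / E)).
{ apply Rmult_le_pos; [lra|]. apply Rdiv_le_0_compat; [|lra]. nra. }
replace ((u - v) * ((D * (u + v) - E) / E))
  with ((D * u ^ 2 - D * v * v) / E - (u - v)) in H by (field; lra).
assert (HDv2 : D * v * v = 1) by (rewrite HDv; unfold v; field; lra).
rewrite HDv2 in H. lra.
Qed.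

(** Any cut [t] up to [threshold] gives a valid bound, since [gap_ge_second_bound] holds for all
    [alpha]; this covers both the exact threshold and its decimal rounding. *)
Lemma lower_bound_le alpha t u G : 0 <= alpha -> t <= threshold -> 0 <= G ->
  ((8 * alpha ^ 2 + 10 * alpha + 5) * u ^ 2 - 1) / (3 * (1 + 2 * alpha)) <= G ->
  lower_bound t alpha <= G - u.
Proof.
intros Ha Ht HG0 HG. unfold lower_bound.
assert (HD : 0 < 8 * alpha ^ 2 + 10 * alpha + 5) by nra.
destruct (Rle_dec alpha t) as [Hle|Hgt].
- apply gap_ge_first_bound with (3 * (1 + 2 * alpha)); try lra; try assumption.
  apply threshold_spec; lra.
- apply gap_ge_second_bound; lra.
Qed.

(** [gamma_2] is the sum of [S / (2 E)], where [S = c2 - c1^2 / 2] is the quantity bounded by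
    hypothesis, and of [k / E * gamma_1^2] with [k = 4 (1 + alpha)^2 - E > 0]; the bound on [|S|]
    is [2 - 8 (1 + alpha)^2 u^2]. *)
Lemma log_coefficients_region alpha (a2 a3 : C) : 0 <= alpha ->
  let c1 := (2 * (1 + alpha) * a2)%C in
  let c2 := (3 * (1 + 2 * alpha) * a3)%C in
  let u := Cmod (a2 / 2) in let G := Cmod ((a3 - a2 ^ 2 / 2) / 2) in
  Cmod (c2 - c1 ^ 2 / 2) <= 2 - Cmod c1 ^ 2 / 2 ->
  ((8 * alpha ^ 2 + 10 * alpha + 5) * u ^ 2 - 1) / (3 * (1 + 2 * alpha)) <= G
    <= 1 / (3 * (1 + 2 * alpha)) - u ^ 2.
Proof.
intros Ha c1 c2 u G H.
set (E := 3 * (1 + 2 * alpha)). assert (HE : 0 < E) by (unfold E; lra).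
set (S := (c2 - c1 ^ 2 / 2)%C) in *.
set (k := 4 * alpha ^ 2 + 2 * alpha + 1). assert (Hk : 0 < k) by (unfold k; nra).
assert (EG : ((a3 - a2 ^ 2 / 2) / 2)%C = (RtoC (/ (2 * E)) * S + RtoC (k / E) * (a2 / 2) ^ 2)%C).
{ assert (HE1 : (3 * (1 + 2 * alpha))%C <> 0%C).
  { intros X. assert (E = 0); [|lra]. apply RtoC_inj.
    unfold E. rewrite RtoC_mult, RtoC_plus, RtoC_mult. exact X. }
  assert (H1 : (1 + 2 * alpha)%C <> 0%C).
  { intros X. apply HE1. rewrite X. ring. }
  unfold S, c1, c2. rewrite RtoC_div, RtoC_inv by lra. unfold E, k.
  rewrite !RtoC_plus, !RtoC_mult, !RtoC_plus, !RtoC_mult, RtoC_pow. field. exact H1. }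
assert (Hc1 : Cmod c1 = 4 * (1 + alpha) * u).
{ unfold c1, u. rewrite Cmod_div, !Cmod_mult, <- RtoC_plus, !Cmod_R, !Rabs_pos_eq by
    (lra || (intros X; apply RtoC_inj in X; lra)).
  field. }
rewrite Hc1 in H.
set (v := (RtoC (k / E) * (a2 / 2) ^ 2)%C) in *.
assert (Hv : Cmod v = k / E * u ^ 2).
{ unfold v, u. rewrite Cmod_mult, Cmod_pow, Cmod_R, Rabs_pos_eq; [reflexivity|].
  apply Rlt_le, Rdiv_lt_0_compat; lra. }
set (w := (RtoC (/ (2 * E)) * S)%C) in *.
assert (Hw : Cmod w <= (1 - 4 * (1 + alpha) ^ 2 * u ^ 2) / E).
{ unfold w. rewrite Cmod_mult, Cmod_R, Rabs_pos_eq by (apply Rlt_le, Rinv_0_lt_compat; lra).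
  replace ((1 - 4 * (1 + alpha) ^ 2 * u ^ 2) / E)
    with (/ (2 * E) * (2 - (4 * (1 + alpha) * u) ^ 2 / 2)) by (field; lra).
  apply Rmult_le_compat_l; [|exact H]. apply Rlt_le, Rinv_0_lt_compat; lra. }
unfold G. rewrite EG.
assert (T1 := Cmod_triangle w v). assert (T2 := Cmod_triangle_rev v w).
replace (v + w)%C with (w + v)%C in T2 by ring.
rewrite Hv in T1, T2.
assert (I1 : (1 - 4 * (1 + alpha) ^ 2 * u ^ 2) / E + k / E * u ^ 2 = 1 / E - u ^ 2).
{ unfold k, E. field. lra. }
assert (I2 : k / E * u ^ 2 - (1 - 4 * (1 + alpha) ^ 2 * u ^ 2) / E
  = ((8 * alpha ^ 2 + 10 * alpha + 5) * u ^ 2 - 1) / E).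
{ unfold k, E. field. lra. }
rewrite <- I1, <- I2. lra.
Qed.

(** * Extremal functions *)

Lemma is_csum_geom (w : C) : Cmod w < 1 -> is_csum (fun n => w ^ n)%C (/ (1 - w)).
Proof.
intros Hw.
assert (H1 : (1 - w)%C <> 0%C).
{ intros E. assert (E2 : w = 1%C) by (replace w with (1 - (1 - w))%C by ring; rewrite E; ring).
  rewrite E2, Cmod_1 in Hw. lra. }
destruct (ex_csum_abs (fun n => w ^ n)%C (fun n => Cmod w ^ n)) as [l Hl].
- intros n. rewrite Cmod_pow. lra.
- apply ex_series_geom. rewrite Rabs_pos_eq; [exact Hw|apply Cmod_ge_0].
- replace (/ (1 - w))%C with l; [exact Hl|].
  assert (E : (l - 1)%C = (w * l)%C).
  { apply (is_csum_unique (fun n => w ^ S n)%C).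
    - exact (is_csum_tail _ _ Hl).
    - exact (is_csum_scal w _ _ Hl). }
  replace l with ((l - w * l) / (1 - w))%C by (field; exact H1).
  rewrite <- E. field. exact H1.
Qed.

(** [2 Re (1 - w) - |1 - w|^2 = 1 - |w|^2]. *)
Lemma Re_inv_1_minus (w : C) : Cmod w < 1 -> / 2 < Re (/ (1 - w)).
Proof.
intros Hw.
assert (Hw2 : Cmod w ^ 2 < 1).
{ pose proof (Cmod_ge_0 w). simpl. nra. }
rewrite Cmod2_alt in Hw2. destruct w as [x y]. unfold Re, Im in *; simpl in *.
assert (Hd : 0 < (1 + - x) * ((1 + - x) * 1) + (0 + - y) * ((0 + - y) * 1)) by nra.
apply Rmult_lt_reg_r with (1 := Hd). unfold Rdiv. rewrite Rmult_assoc, Rinv_l by lra. nra.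
Qed.

Definition extremal_density_coef (eta : C) (n : nat) : C :=
  match n with O => 1 | _ => eta ^ n + Cconj eta ^ n end.

(** Dividing by [(m + 1) (1 + alpha m)] solves [f' + alpha z f'' = p] coefficientwise. *)
Definition extremal_coef (alpha : R) (eta : C) (n : nat) : C :=
  match n with
  | O => 0
  | S m => extremal_density_coef eta m * RtoC (/ (INR (S m) * (1 + alpha * INR m)))
  end.

(** The sum is [1 / (1 - eta z) + 1 / (1 - conj eta z) - 1]. *)
Lemma extremal_density_sum (eta z : C) : Cmod eta = 1 -> Cmod z < 1 ->
  exists l, is_ps (extremal_density_coef eta) z l /\ 0 < Re l.
Proof.
intros He Hz.
assert (H1 : Cmod (eta * z) < 1) by (rewrite Cmod_mult, He; lra).
assert (H2 : Cmod (Cconj eta * z) < 1) by (rewrite Cmod_mult, Cmod_conj, He; lra).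
exists (/ (1 - eta * z) + / (1 - Cconj eta * z) - 1)%C. split.
- assert (Hone : is_csum (fun n => match n with O => 1 | _ => 0 end)%C 1).
  { assert (H := is_csum_cons (fun n => match n with O => 1 | _ => 0 end)%C _ is_csum_zero).
    rewrite Cplus_0_l in H. exact H. }
  assert (H := is_csum_minus _ _ _ _
    (is_csum_plus _ _ _ _ (is_csum_geom _ H1) (is_csum_geom _ H2)) Hone).
  revert H. apply is_csum_ext. intros [|n]; unfold extremal_density_coef.
  + simpl. ring.
  + rewrite !Cpow_mult_l. ring.
- assert (P1 := Re_inv_1_minus _ H1). assert (P2 := Re_inv_1_minus _ H2).
  unfold Cminus at 1. rewrite !re_plus, re_opp, re_RtoC. lra.
Qed.

Lemma Cmod_extremal_coef alpha eta n : 0 <= alpha -> Cmod eta = 1 ->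
  Cmod (extremal_coef alpha eta n) <= 2.
Proof.
intros Ha He. destruct n as [|m]; unfold extremal_coef; [rewrite Cmod_0; lra|].
rewrite Cmod_mult, Cmod_R.
assert (Hm := pos_INR m). assert (Hden : 1 <= INR (S m) * (1 + alpha * INR m)).
{ rewrite S_INR. assert (0 <= alpha * INR m) by now apply Rmult_le_pos.
  assert (0 <= INR m * (alpha * INR m)) by now apply Rmult_le_pos. lra. }
assert (Hi : 0 <= / (INR (S m) * (1 + alpha * INR m)) <= 1).
{ split; [apply Rlt_le, Rinv_0_lt_compat; lra|].
  rewrite <- Rinv_1. apply Rinv_le_contravar; lra. }
assert (Hc : Cmod (extremal_density_coef eta m) <= 2).
{ destruct m; unfold extremal_density_coef; [rewrite Cmod_1; lra|].
  eapply Rle_trans; [apply Cmod_triangle|].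
  rewrite !Cmod_pow, Cmod_conj, He, pow1. lra. }
rewrite Rabs_pos_eq by lra. pose proof (Cmod_ge_0 (extremal_density_coef eta m)). nra.
Qed.

Lemma ps_function a rho : abs_conv a rho ->
  exists F, forall z, Cmod z < rho -> is_ps a z (F z).
Proof.
intros Ha. exists (fun z => epsilon (inhabits (RtoC 0)) (fun l => is_ps a z l)).
intros z Hz. apply epsilon_spec. now apply abs_conv_ps with rho.
Qed.

Lemma extremal_function alpha eta : 0 <= alpha -> Cmod eta = 1 ->
  exists f, class_W alpha f /\ forall z, Cmod z < 1 -> is_ps (extremal_coef alpha eta) z (f z).
Proof.
intros Ha He. set (a := extremal_coef alpha eta).
assert (Hconv : abs_conv a 1).
{ apply abs_conv_bounded. intros s Hs. exists 2. intros n.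
  assert (H := Cmod_extremal_coef alpha eta n Ha He). fold a in H.
  assert (0 <= s ^ n <= 1).
  { split; [apply pow_le; lra|]. rewrite <- (pow1 n). apply pow_incr; lra. }
  pose proof (Cmod_ge_0 (a n)). nra. }
destruct (ps_function a 1 Hconv) as [f Hf]. exists f. split; [|exact Hf].
assert (D1 := ps_C_derive a 1 f Rlt_0_1 Hf).
assert (D2 := ps_C_derive _ 1 _ Rlt_0_1 (fun z Hz => proj2 (D1 z Hz))).
assert (Hz0 : Cmod 0 < 1) by (rewrite Cmod_0; lra).
split; [split; [|split]|].
- intros z Hz. apply ex_derive_cderiv. eexists. apply (D1 z Hz).
- apply (is_ps_0 a), Hf, Hz0.
- rewrite (is_ps_0 _ _ (proj2 (D1 0%C Hz0))). unfold deriv_coef, a, extremal_coef, extremal_density_coef.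
  change (INR 1) with 1. change (INR 0) with 0. rewrite Rmult_0_r, Rplus_0_r, Rmult_1_r, Rinv_1. ring.
- intros z Hz. destruct (extremal_density_sum eta z He Hz) as [l [Hl Hpos]].
  replace (C_derive f z + alpha * z * C_derive (C_derive f) z)%C with l; [exact Hpos|].
  apply (is_csum_unique _ _ _ Hl).
  assert (Hz2 : is_csum (fun n => INR n * deriv_coef a n * z ^ n)%C (z * C_derive (C_derive f) z)).
  { replace (z * C_derive (C_derive f) z)%C
      with (z * C_derive (C_derive f) z + INR 0 * deriv_coef a 0 * z ^ 0)%C
      by (change (INR 0) with 0; ring).
    apply (is_csum_cons (fun n => INR n * deriv_coef a n * z ^ n)%C).
    assert (H := is_csum_scal z _ _ (proj2 (D2 z Hz))). revert H. apply is_csum_ext.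
    intros n. unfold deriv_coef at 1. simpl Cpow. ring. }
  assert (H := is_csum_plus _ _ _ _ (proj2 (D1 z Hz)) (is_csum_scal alpha _ _ Hz2)).
  rewrite Cmult_assoc in H. revert H. apply is_csum_ext.
  intros n.
  assert (E : (deriv_coef a n * (1 + alpha * INR n))%C = extremal_density_coef eta n).
  { unfold deriv_coef, a, extremal_coef.
    assert (Hn := pos_INR n). assert (0 <= alpha * INR n) by now apply Rmult_le_pos.
    assert (HS : INR (S n) <> 0) by (rewrite S_INR; lra).
    rewrite <- RtoC_mult, <- RtoC_plus.
    replace (INR (S n) * (extremal_density_coef eta n * RtoC (/ (INR (S n) * (1 + alpha * INR n))))
       * RtoC (1 + alpha * INR n))%C
      with (extremal_density_coef eta n *
        RtoC (INR (S n) * / (INR (S n) * (1 + alpha * INR n)) * (1 + alpha * INR n)))%C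
      by (rewrite !RtoC_mult; ring).
    replace (INR (S n) * / (INR (S n) * (1 + alpha * INR n)) * (1 + alpha * INR n)) with 1
      by (field; lra).
    ring. }
  rewrite <- E. ring.
Qed.

(** * Existence of the logarithmic coefficients *)

Lemma cderiv_zero_const F rho : (forall z, Cmod z < rho -> is_cderiv F z 0) ->
  forall z : C, Cmod z < rho -> F z = F 0%C.
Proof.
intros HF z Hz.
assert (H := is_CInt_FTC (fun s => F (0 + RtoC s * z)%C) (fun _ => (0 * z)%C) 0 1).
assert (H' : is_CInt (fun _ => (0 * z)%C) 0 1 (F (0 + 1 * z)%C - F (0 + 0 * z)%C)).
{ apply H; rewrite Rmin_left, Rmax_right by lra.
  - intros t Ht. apply (path_deriv_comp F (fun s => 0 + RtoC s * z)%C); [|apply path_deriv_affine].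
    apply HF. rewrite Cplus_0_l, Cmod_mult, Cmod_R, Rabs_pos_eq by lra.
    pose proof (Cmod_ge_0 z). nra.
  - intros t _. apply path_cont_const. }
assert (H2 := is_CInt_const (0 * z)%C 0 1).
assert (E : (F (0 + 1 * z)%C - F (0 + 0 * z)%C)%C = (RtoC (1 - 0) * (0 * z))%C).
{ rewrite <- (is_CInt_unique _ _ _ _ H'). now apply is_CInt_unique. }
replace (0 + 1 * z)%C with z in E by ring. replace (0 + 0 * z)%C with (RtoC 0) in E by ring.
apply Ceq_minus. rewrite E. ring.
Qed.

(** With [g z = f z / z], which is 1 at 0, take for [L] the primitive of [g' / (2 g)] that vanishes
    at 0.  Then [Cexp (2 L) / g] has derivative zero and value 1 at 0.  Taking the power
    series of [g' / g] from [taylor_disk] avoids composing power series. *)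
Lemma log_coefficients_exist f a :
  (forall z, Cmod z < 1 -> is_ps a z (f z)) -> a 0%nat = 0%C -> a 1%nat = 1%C ->
  exists gamma, log_coefficients f gamma.
Proof.
intros Ha Ha0 Ha1.
assert (Hquot : forall z, 0 < Cmod z < 1 -> is_ps (fun n => a (S n)) z (f z / z)%C).
{ intros z [Hz0 Hz]. apply ps_div_z; [exact Ha0|now apply Ha|now apply Cmod_gt_0]. }
destruct (ps_function (fun n => a (S n)) 1) as [g Hg].
{ apply ps_abs_conv. intros z Hz. exists (f z / z)%C. now apply Hquot. }
assert (Hgq : forall z, 0 < Cmod z < 1 -> g z = (f z / z)%C).
{ intros z Hz. apply (is_csum_unique _ _ _ (Hg z (proj2 Hz)) (Hquot z Hz)). }
assert (D1 := ps_C_derive _ 1 g Rlt_0_1 Hg).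
assert (D2 := ps_C_derive _ 1 _ Rlt_0_1 (fun z Hz => proj2 (D1 z Hz))).
assert (Hz0 : Cmod 0 < 1) by (rewrite Cmod_0; lra).
assert (Hg0 : g 0%C = 1%C) by (rewrite (is_ps_0 _ _ (Hg 0%C Hz0)); exact Ha1).
destruct (cderiv_cont g 0 _ (proj1 (D1 0%C Hz0)) (1 / 2) ltac:(lra)) as [d [Hd Hgd]].
set (rho := Rmin d 1). assert (Hr1 : rho <= d) by apply Rmin_l. assert (Hr2 : rho <= 1) by apply Rmin_r.
assert (Hrho : 0 < rho) by (apply Rmin_case; lra).
assert (Hgn : forall z, Cmod z < rho -> g z <> 0%C).
{ intros z Hz E. assert (H := Hgd z). rewrite E, Hg0 in H.
  replace (z - 0)%C with z in H by ring. replace (0 - 1)%C with (- (1))%C in H by ring.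
  rewrite Cmod_opp, Cmod_1 in H. specialize (H ltac:(lra)). lra. }
set (h := fun z => (C_derive g z / g z)%C).
destruct (taylor_disk h rho Hrho) as [b [Hb _]].
{ intros z Hz. eexists. apply cderiv_div; [now apply Hgn| |].
  - apply D2. lra.
  - apply D1. lra. }
set (gamma := fun n => match n with O => RtoC 0 | S m => (b m * RtoC (/ INR (S m) / 2))%C end).
assert (Hgc : abs_conv gamma rho).
{ intros s Hs. apply (ex_series_incr_1 (fun n => Cmod (gamma n) * s ^ n)).
  assert (Hbc : abs_conv b rho).
  { apply ps_abs_conv. intros z Hz. exists (h z). apply Hb. lra. }
  apply (ex_series_le (K := R_AbsRing) (V := R_CompleteNormedModule))
    with (fun n => s * (Cmod (b n) * s ^ n)).
  - intros n. change (Rabs (Cmod (gamma (S n)) * s ^ S n) <= s * (Cmod (b n) * s ^ n)).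
    assert (Hsn : 0 <= s ^ S n) by (apply pow_le; lra).
    rewrite Rabs_pos_eq by (apply Rmult_le_pos; [apply Cmod_ge_0|exact Hsn]).
    replace (s * (Cmod (b n) * s ^ n)) with (Cmod (b n) * s ^ S n) by (simpl; ring).
    apply Rmult_le_compat_r; [exact Hsn|]. unfold gamma. rewrite Cmod_mult, Cmod_R.
    assert (HS : 1 <= INR (S n)) by (rewrite S_INR; pose proof (pos_INR n); lra).
    assert (0 < / INR (S n) <= 1).
    { split; [apply Rinv_0_lt_compat; lra|]. rewrite <- Rinv_1. apply Rinv_le_contravar; lra. }
    rewrite Rabs_pos_eq by lra. pose proof (Cmod_ge_0 (b n)). nra.
  - apply (ex_series_scal_l (K := R_AbsRing) (V := R_NormedModule) s). apply Hbc. exact Hs. }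
destruct (ps_function gamma rho Hgc) as [L HL].
assert (HdL : forall z, Cmod z < rho -> is_cderiv L z (h z * / 2)).
{ intros z Hz. apply ps_cderiv with gamma rho; try assumption.
  assert (H := is_csum_scal (/ 2) _ _ (Hb z Hz)).
  replace (h z * / 2)%C with (/ 2 * h z)%C by ring. revert H. apply is_csum_ext.
  intros n. unfold deriv_coef, gamma.
  assert (HS : INR (S n) <> 0) by (rewrite S_INR; pose proof (pos_INR n); lra).
  assert (HS' : RtoC (INR (S n)) <> 0%C) by (intros E; apply RtoC_inj in E; lra).
  rewrite RtoC_div, RtoC_inv by (assumption || lra). field. exact HS'. }
assert (HL0 : L 0%C = 0%C).
{ rewrite (is_ps_0 gamma (L 0%C)); [reflexivity|]. apply HL. rewrite Cmod_0; lra. }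
set (M := fun z => (Cexp (2 * L z) / g z)%C).
assert (HM : forall z, Cmod z < rho -> is_cderiv M z 0).
{ intros z Hz.
  assert (H1 : is_cderiv (fun z => Cexp (2 * L z)) z (Cexp (2 * L z) * (2 * (h z * / 2)))).
  { apply (cderiv_comp Cexp (fun z => 2 * L z)%C); [apply cderiv_Cexp|].
    apply cderiv_scal, HdL, Hz. }
  assert (H2 := cderiv_div _ g z _ _ (Hgn z Hz) H1 (proj1 (D1 z ltac:(lra)))).
  match type of H2 with is_cderiv _ _ ?x => assert (E : x = 0%C) end.
  { unfold h. field. now apply Hgn. }
  cbv beta in E, H2. rewrite E in H2. exact H2. }
exists gamma, rho. split; [exact Hrho|]. intros z Hz.
exists (L z). split.
- assert (H := is_csum_tail _ _ (HL z (proj2 Hz))). cbv beta in H.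
  replace (L z - gamma 0%nat * z ^ 0)%C with (L z) in H by (simpl; ring). exact H.
- rewrite <- Hgq by lra.
  assert (E := cderiv_zero_const M rho HM z (proj2 Hz)). unfold M in E.
  rewrite HL0, Hg0, Cmult_0_r, Cexp_0 in E.
  replace (Cexp (2 * L z)) with (Cexp (2 * L z) / g z * g z)%C by (field; apply Hgn; lra).
  rewrite E. field.
Qed.

(** * Sharpness and conclusion *)

(** With [Re eta = 2 (1 + alpha) u] the coefficients are [a2 = 2 u] and
    [a3 = (4 (Re eta)^2 - 2) / E], both real. *)
Lemma extremal_gap alpha u : 0 <= alpha -> 0 <= u <= 1 / (2 * (1 + alpha)) ->
  exists f gamma, class_W alpha f /\ log_coefficients f gamma /\
    log_coeff_gap gamma =
      Rabs (((8 * alpha ^ 2 + 10 * alpha + 5) * u ^ 2 - 1) / (3 * (1 + 2 * alpha))) - u.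
Proof.
intros Ha Hu.
set (x := 2 * (1 + alpha) * u).
assert (Hx : 0 <= x <= 1).
{ unfold x. split; [apply Rmult_le_pos; lra|].
  apply Rmult_le_reg_r with (1 / (2 * (1 + alpha))).
  - apply Rdiv_lt_0_compat; lra.
  - replace (2 * (1 + alpha) * u * (1 / (2 * (1 + alpha)))) with u by (field; lra). lra. }
assert (Hy : 0 <= 1 - x ^ 2) by nra.
set (eta := (x, sqrt (1 - x ^ 2)) : C).
assert (He : Cmod eta = 1).
{ unfold Cmod, eta; simpl fst; simpl snd. rewrite pow2_sqrt by exact Hy.
  transitivity (sqrt 1); [f_equal; ring|apply sqrt_1]. }
destruct (extremal_function alpha eta Ha He) as [f [HW Hf]].
assert (E2 : extremal_coef alpha eta 2 = RtoC (2 * u)).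
{ unfold extremal_coef, extremal_density_coef.
  replace (eta ^ 1 + Cconj eta ^ 1)%C with (RtoC (2 * x)).
  - rewrite <- RtoC_mult. f_equal. rewrite INR_2. change (INR 1) with 1. unfold x. field. lra.
  - unfold eta, Cconj, RtoC, Cpow, Cplus, Cmult; simpl. f_equal; ring. }
assert (E3 : extremal_coef alpha eta 3 = RtoC ((4 * x ^ 2 - 2) / (3 * (1 + 2 * alpha)))).
{ unfold extremal_coef, extremal_density_coef.
  replace (eta ^ 2 + Cconj eta ^ 2)%C with (RtoC (4 * x ^ 2 - 2)).
  - rewrite <- RtoC_mult. f_equal. rewrite INR_3, INR_2. field. lra.
  - assert (Hs := sqrt_sqrt (1 - x ^ 2) Hy).
    unfold eta, Cconj, RtoC, Cpow, Cplus, Cmult; simpl in *. f_equal; [|ring].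
    set (q := sqrt _) in *. nra. }
assert (Ea1 : extremal_coef alpha eta 1 = 1%C).
{ unfold extremal_coef, extremal_density_coef. change (INR 1) with 1. change (INR 0) with 0.
  rewrite Rmult_0_r, Rplus_0_r, Rmult_1_r, Rinv_1. ring. }
destruct (log_coefficients_exist f _ Hf eq_refl Ea1) as [gamma Hg].
exists f, gamma. split; [exact HW|]. split; [exact Hg|].
destruct (log_coefficients_values f gamma _ Hf eq_refl Ea1 Hg) as [G1 G2].
unfold log_coeff_gap. rewrite G1, G2, E2, E3.
rewrite <- RtoC_pow, <- !RtoC_div, <- RtoC_minus, <- RtoC_div, !Cmod_R by lra.
rewrite (Rabs_pos_eq (2 * u / 2)) by lra. f_equal; [|field].
f_equal. unfold x. field. lra.
Qed.

Theorem theorem4p1 (alpha : R) (halpha : 0 <= alpha) :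
  (forall (f : C -> C) (gamma : nat -> C),
     class_W alpha f -> log_coefficients f gamma ->
     lower_bound (2232 / 1000) alpha <= log_coeff_gap gamma
       <= 1 / (3 * (1 + 2 * alpha))
     /\ lower_bound threshold alpha <= log_coeff_gap gamma)
  /\
  (exists (f : C -> C) (gamma : nat -> C),
     class_W alpha f /\ log_coefficients f gamma /\
     log_coeff_gap gamma = 1 / (3 * (1 + 2 * alpha)))
  /\
  (exists (f : C -> C) (gamma : nat -> C),
     class_W alpha f /\ log_coefficients f gamma /\
     log_coeff_gap gamma = lower_bound threshold alpha).
Proof.
split; [|split].
- intros f gamma HW Hlog.
  destruct (class_W_coefficients alpha f HW) as [a [Hps [Ha0 [Ha1 Hc]]]].
  destruct (log_coefficients_values f gamma a Hps Ha0 Ha1 Hlog) as [E1 E2].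
  destruct (log_coefficients_region alpha (a 2%nat) (a 3%nat) halpha Hc) as [Hlow Hup].
  rewrite <- E1, <- E2 in Hlow, Hup. unfold log_coeff_gap.
  assert (HG := Cmod_ge_0 (gamma 2%nat)). assert (Hu := Cmod_ge_0 (gamma 1%nat)).
  split; [split|].
  + apply lower_bound_le; try assumption. apply decimal_le_threshold.
  + pose proof (pow2_ge_0 (Cmod (gamma 1%nat))). lra.
  + apply lower_bound_le; try assumption. lra.
- destruct (extremal_gap alpha 0 halpha) as [f [gamma [HW [Hlog Hgap]]]].
  { split; [lra|]. apply Rlt_le, Rdiv_lt_0_compat; lra. }
  exists f, gamma. split; [exact HW|]. split; [exact Hlog|]. rewrite Hgap.
  replace (((8 * alpha ^ 2 + 10 * alpha + 5) * 0 ^ 2 - 1) / (3 * (1 + 2 * alpha)))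
    with (- (1 / (3 * (1 + 2 * alpha)))) by (field; lra).
  rewrite Rabs_Ropp, Rabs_pos_eq; [ring|]. apply Rlt_le, Rdiv_lt_0_compat; lra.
- set (D := 8 * alpha ^ 2 + 10 * alpha + 5). set (E := 3 * (1 + 2 * alpha)).
  assert (HD : 0 < D) by (unfold D; nra). assert (HE : 0 < E) by (unfold E; lra).
  assert (Hs : 0 < sqrt D) by now apply sqrt_lt_R0.
  assert (Hss := sqrt_sqrt D (Rlt_le _ _ HD)).
  unfold lower_bound. fold D. fold E. destruct (Rle_dec alpha threshold) as [Hle|Hgt].
  + destruct (extremal_gap alpha (1 / sqrt D) halpha) as [f [gamma [HW [Hlog Hgap]]]].
    { split; [apply Rlt_le, Rdiv_lt_0_compat; lra|].
      apply Rmult_le_compat_l; [lra|]. apply Rinv_le_contravar; [lra|].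
      apply Rsqr_incr_0_var; [|lra]. unfold Rsqr. rewrite Hss. unfold D. nra. }
    exists f, gamma. split; [exact HW|]. split; [exact Hlog|]. rewrite Hgap.
    fold D. fold E.
    replace (D * (1 / sqrt D) ^ 2) with 1.
    * replace ((1 - 1) / E) with 0 by (field; lra). rewrite Rabs_R0. ring.
    * rewrite <- Hss at 1. field. lra.
  + destruct (extremal_gap alpha (E / (2 * D)) halpha) as [f [gamma [HW [Hlog Hgap]]]].
    { split; [apply Rlt_le, Rdiv_lt_0_compat; lra|].
      apply Rmult_le_reg_r with (2 * D * (2 * (1 + alpha))); [apply Rmult_lt_0_compat; lra|].
      replace (E / (2 * D) * (2 * D * (2 * (1 + alpha)))) with (E * (2 * (1 + alpha))) by (field; lra).
      replace (1 / (2 * (1 + alpha)) * (2 * D * (2 * (1 + alpha)))) with (2 * D) by (field; lra).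
      unfold E, D. nra. }
    exists f, gamma. split; [exact HW|]. split; [exact Hlog|]. rewrite Hgap.
    fold D. fold E.
    assert (HED : 4 * D < E ^ 2).
    { apply Rnot_le_lt. intros H. apply Hgt. now apply threshold_spec. }
    replace ((D * (E / (2 * D)) ^ 2 - 1) / E) with ((E ^ 2 - 4 * D) / (4 * D * E)) by (field; lra).
    rewrite Rabs_pos_eq.
    * field. lra.
    * apply Rlt_le, Rdiv_lt_0_compat; [lra|]. apply Rmult_lt_0_compat; lra.
Qed.
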